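(* For any word $w\in S$, the generalized inversion formula $$\sum_{uv=w}\mathrm{Li}(\tau(u);1-z)\,\mathrm{Li}(v;z)=\zeta(\mathrm{reg}^{10}(w))$$ holds for all $z\in\mathbf{D}_0\cap\mathbf{D}_1$.
   Context: Domains: $\mathbf{D}_0=\mathbf{C}\setminus\{x\in\mathbf{R}: x\ge 1\}$, $\mathbf{D}_1=\mathbf{C}\setminus\{x\in\mathbf{R}: x\le 0\}$. $\log z$ denotes the principal branch on $\mathbf{D}_1$. Shuffle algebra: $\xi_0=\frac{dz}{z}$, $\xi_1=\frac{dz}{1-z}$. $S=S(\xi_0,\xi_1)$ is the vector space $\mathbf{C}\langle\xi_0,\xi_1\rangle$ of non-commutative polynomials in the letters $\xi_0,\xi_1$ (with basis the words; the empty word is denoted $\mathbf{1}$), equipped with the shuffle product ⧢, the bilinear product defined recursively by $w$ ⧢ $\mathbf{1}=\mathbf{1}$ ⧢ $w=w$ and $(\xi_{i}w_1)$ ⧢ $(\xi_{j}w_2)=\xi_{i}\big(w_1$ ⧢ $(\xi_{j}w_2)\big)+\xi_{j}\big((\xi_{i}w_1)$ ⧢ $w_2\big)$. Juxtaposition and powers such as $\xi_0^j$ denote concatenation. A sum $\sum_{uv=w}$ runs over all factorizations of the word $w$ as a concatenation of two (possibly empty) words $u,v$. $\tau:S\to S$ is the linear map reversing words and exchanging letters, i.e. the anti-automorphism for concatenation with $\tau(\xi_0)=\xi_1$, $\tau(\xi_1)=\xi_0$. Subalgebras: $S^0=\mathbf{C}\mathbf{1}+S\xi_1$, $S^{10}=\mathbf{C}\mathbf{1}+\xi_0S\xi_1$.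 Every $w\in S$ can be written uniquely as $w=\sum_j w_j$ ⧢ $\xi_0^j$ with $w_j\in S^0$, and uniquely as $w=\sum_{i,j}\xi_1^i$ ⧢ $w_{ij}$ ⧢ $\xi_0^j$ with $w_{ij}\in S^{10}$ (finite sums). The regularizing map $\mathrm{reg}^{10}:S\to S^{10}$ is defined by $\mathrm{reg}^{10}(w)=w_{00}$. Multiple polylogarithms: for a word $w=\xi_{i_1}\cdots\xi_{i_r}\in S^0$ (so $i_r=1$ if $r\ge1$) and $z\in\mathbf{D}_0$, $\mathrm{Li}(w;z)=\int_0^z w$ is the iterated integral along a path in $\mathbf{D}_0$, defined recursively by $\int_0^z\mathbf{1}=1$ and $\int_0^z w=\int_0^z\xi_{i_1}(t)\big(\int_0^t\xi_{i_2}\cdots\xi_{i_r}\big)$, extended linearly to $S^0$; it is holomorphic on $\mathbf{D}_0$, and $\mathrm{Li}(\xi_0^{k_1-1}\xi_1\cdots\xi_0^{k_r-1}\xi_1;z)=\sum_{n_1>\cdots>n_r>0}\frac{z^{n_1}}{n_1^{k_1}\cdots n_r^{k_r}}$ for $|z|<1$. The extended multiple polylogarithm of $w=\sum_j w_j$ ⧢ $\xi_0^j\in S$ ($w_j\in S^0$) is $\mathrm{Li}(w;z)=\sum_j\mathrm{Li}(w_j;z)\frac{\log^j z}{j!}$, holomorphic on $\mathbf{D}_0\cap\mathbf{D}_1$. Multiple zeta values: $\zeta:S^{10}\to\mathbf{C}$ is the linear map $\zeta(w)=\lim_{z\to1,\,z\in\mathbf{D}_0\cap\mathbf{D}_1}\mathrm{Li}(w;z)$;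 so $\zeta(\mathbf{1})=1$ and $\zeta(\xi_0^{k_1-1}\xi_1\cdots\xi_0^{k_r-1}\xi_1)=\sum_{n_1>\cdots>n_r>0}\frac{1}{n_1^{k_1}\cdots n_r^{k_r}}$ for $k_1\ge2$, $k_2,\dots,k_r\ge1$. *)

(* Defs.v *)
From Stdlib Require Export Reals List Factorial ClassicalEpsilon.
From Stdlib Require Import Lra.
From Coquelicot Require Export Coquelicot.
Export ListNotations.
Open Scope R_scope.
Open Scope C_scope.

Definition D0 (z : C) : Prop := ~ (Im z = 0%R /\ (1 <= Re z)%R).
Definition D1 (z : C) : Prop := ~ (Im z = 0%R /\ (Re z <= 0)%R).

(* Half-angle formula for the principal argument, valid on [D1]; see
   [Clog_principal]. *)
Definition Carg (z : C) : R := (2 * atan (Im z / (Cmod z + Re z)))%R.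
Definition Clog (z : C) : C := (ln (Cmod z), Carg z).

Lemma Clog_principal (z : C) (hz : D1 z) :
  (z = RtoC (exp (Re (Clog z))) * (cos (Im (Clog z)), sin (Im (Clog z))))
  /\ (- PI < Im (Clog z) < PI)%R.
Proof.
destruct z as [x y]; unfold D1 in hz; simpl in hz.
assert (hr2 : (Cmod (x, y) * Cmod (x, y) = x * x + y * y)%R).
{ unfold Cmod; simpl; rewrite sqrt_sqrt; nra. }
pose proof (Cmod_ge_0 (x, y)) as hr0.
unfold Clog, Carg; simpl.
set (r := Cmod (x, y)) in *.
assert (hrx : (0 < r + x)%R).
{ destruct (Rle_or_lt (r + x) 0) as [h|h]; [exfalso|exact h].
  apply hz; split; nra. }
assert (hr : (0 < r)%R) by nra.
set (t := (y / (r + x))%R).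
split.
- rewrite exp_ln by exact hr.
  assert (hs0 : (0 < 1 + t * t)%R) by nra.
  assert (hs : (sqrt (1 + t * t) * sqrt (1 + t * t) = 1 + t * t)%R)
    by (apply sqrt_sqrt; lra).
  assert (hq : (0 < sqrt (1 + t * t))%R) by (apply sqrt_lt_R0; exact hs0).
  assert (ht : (1 + t * t = 2 * r / (r + x))%R).
  { replace (1 + t * t)%R with (((r + x) * (r + x) + y * y) / ((r + x) * (r + x)))%R
      by (unfold t; field; lra).
    replace (y * y)%R with (r * r - x * x)%R by lra.
    field; lra. }
  assert (hc : cos (2 * atan t) = (x / r)%R).
  { rewrite cos_2a, cos_atan, sin_atan; unfold Rsqr.
    replace (1 / sqrt (1 + t * t) * (1 / sqrt (1 + t * t)) -
             t / sqrt (1 + t * t) * (t / sqrt (1 + t * t)))%R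
      with ((2 - (1 + t * t)) / (sqrt (1 + t * t) * sqrt (1 + t * t)))%R
      by (field; lra).
    rewrite hs, ht; field; lra. }
  assert (hn : sin (2 * atan t) = (y / r)%R).
  { rewrite sin_2a, cos_atan, sin_atan; unfold Rsqr.
    replace (2 * (t / sqrt (1 + t * t)) * (1 / sqrt (1 + t * t)))%R
      with (2 * t / (sqrt (1 + t * t) * sqrt (1 + t * t)))%R
      by (field; lra).
    rewrite hs, ht; unfold t; field; lra. }
  rewrite hc, hn; unfold Cmult, RtoC; simpl; f_equal; field; lra.
- destruct (atan_bound t); lra.
Qed.

Inductive letter : Set := xi0 | xi1.

Definition word := list letter.

Definition letter_eq_dec (a b : letter) : {a = b} + {a <> b}.
Proof. decide equality. Defined.

Definition word_eq_dec : forall u v : word, {u = v} + {u <> v} :=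
  list_eq_dec letter_eq_dec.

(* An element of C<xi0, xi1> is represented by a formal linear combination of
   words; concatenation of lists is addition, and two representations denote
   the same element when they are related by [nceq]. *)
Definition ncpoly := list (C * word).

Definition lin (f : word -> C) (p : ncpoly) : C :=
  fold_right (fun t acc => fst t * f (snd t) + acc) 0 p.

Definition coeff (w : word) (p : ncpoly) : C :=
  lin (fun u => if word_eq_dec u w then 1 else 0) p.

Definition nceq (p q : ncpoly) : Prop := forall w, coeff w p = coeff w q.

Definition scale (c : C) (p : ncpoly) : ncpoly :=
  map (fun t => (c * fst t, snd t)) p.

Definition linp (f : word -> ncpoly) (p : ncpoly) : ncpoly :=
  flat_map (fun t => scale (fst t) (f (snd t))) p.

Definition mono (w : word) : ncpoly := [(RtoC 1, w)].

Definition conc (p q : ncpoly) : ncpoly :=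
  linp (fun u => linp (fun v => mono (u ++ v)) q) p.

Fixpoint shuffle_word (u : word) : word -> ncpoly :=
  match u with
  | [] => mono
  | a :: u' =>
      fix aux (v : word) : ncpoly :=
        match v with
        | [] => mono u
        | b :: v' =>
            conc (mono [a]) (shuffle_word u' v) ++ conc (mono [b]) (aux v')
        end
  end.

Definition shuffle (p q : ncpoly) : ncpoly :=
  linp (fun u => linp (fun v => shuffle_word u v) q) p.

Definition swap (a : letter) : letter :=
  match a with xi0 => xi1 | xi1 => xi0 end.

Definition tau (p : ncpoly) : ncpoly :=
  linp (fun u => mono (rev (map swap u))) p.

Definition letter_pow (a : letter) (n : nat) : ncpoly := mono (repeat a n).

Definition ncsum (n : nat) (f : nat -> ncpoly) : ncpoly := flat_map f (seq 0 n).

Definition in_S0 (p : ncpoly) : Prop :=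
  exists (c : C) (q : ncpoly),
    nceq p (scale c (mono []) ++ conc q (mono [xi1])).

Definition in_S10 (p : ncpoly) : Prop :=
  exists (c : C) (q : ncpoly),
    nceq p (scale c (mono []) ++ conc (mono [xi0]) (conc q (mono [xi1]))).

(* The components of the two decompositions are indexed by their position in
   the list, missing ones being zero. *)
Definition decomp0 (p : ncpoly) (ws : list ncpoly) : Prop :=
  List.Forall in_S0 ws /\
  nceq p (ncsum (length ws) (fun j => shuffle (nth j ws []) (letter_pow xi0 j))).

Definition decomp10 (p : ncpoly) (wss : list (list ncpoly)) : Prop :=
  List.Forall (List.Forall in_S10) wss /\
  nceq p
    (ncsum (length wss) (fun i =>
       ncsum (length (nth i wss [])) (fun j =>
         shuffle (shuffle (letter_pow xi1 i) (nth j (nth i wss []) []))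
                 (letter_pow xi0 j)))).

(* Decompositions exist and are unique up to [nceq] and trailing zero
   components, so the choice made by [epsilon] is immaterial. *)
Definition components0 (p : ncpoly) : list ncpoly :=
  epsilon (inhabits []) (decomp0 p).

Definition components10 (p : ncpoly) : list (list ncpoly) :=
  epsilon (inhabits []) (decomp10 p).

Definition reg10 (p : ncpoly) : ncpoly := nth 0 (nth 0 (components10 p) []) [].

Definition form (a : letter) (t : C) : C :=
  match a with xi0 => / t | xi1 => / (1 - t) end.

(* Integral of f(t) dt along the straight path from 0 to z, which stays in
   [D0] when z is in [D0]. *)
Definition path_int (f : C -> C) (z : C) : C :=
  RInt (V := C_R_CompleteNormedModule) (fun s : R => z * f (RtoC s * z)) 0 1.

(* Meaningful on words that are empty or end in [xi1] only: the integrand then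
   extends continuously to 0. *)
Fixpoint Li_word (w : word) (z : C) : C :=
  match w with
  | [] => 1
  | a :: w' => path_int (fun t => form a t * Li_word w' t) z
  end.

(* On [in_S0], words not ending in [xi1] have total coefficient zero. *)
Definition Li0 (p : ncpoly) (z : C) : C := lin (fun w => Li_word w z) p.

Definition Csum (n : nat) (f : nat -> C) : C :=
  fold_right (fun j acc => f j + acc) 0 (seq 0 n).

Definition Li (p : ncpoly) (z : C) : C :=
  let ws := components0 p in
  Csum (length ws) (fun j =>
    Li0 (nth j ws []) z * (Clog z ^ j / RtoC (INR (fact j)))).

Definition zeta (p : ncpoly) : C :=
  iota (T := CompleteNormedModule.CompleteSpace _ C_R_CompleteNormedModule)
    (fun l : C =>
       filterlim (fun z : C => Li p z)
         (within (fun z : C => D0 z /\ D1 z) (locally (RtoC 1))) (locally l)).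

(* Main.v *)
From Stdlib Require Import Lra Lia.
Require Import Defs.

(* For fixed z the extended polylogarithm is a character Li(.; z) of the shuffle
   algebra, and d Li(a w; z) = a(z) Li(w; z).  Reversal and exchange of letters
   preserves shuffles, and the concatenation convolution of two characters is a
   character, so the left-hand side of the formula is a character G_z of S.  Its
   z-derivative telescopes to 0, hence G_z = G is constant in z.  On single
   letters G vanishes, since Li(xi1; 1 - z) = - log z; hence G kills every term
   xi1^i sh w_ij sh xi0^j with (i, j) <> (0, 0), and G(w) = G(reg w).  Finally
   G = zeta on S10: as z -> 1 the terms with u nonempty are O(|1 - z|) up to
   powers of the logarithm, the growth of Li(v; z) at 1 being itself read off
   from the constancy of G by induction on the length of v.

   Only the existence of the decompositions defining Li and reg is needed: any
   decomposition gives the same value under a character. *)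

(** * Complex derivatives *)

(** The decompositions behind [Li] and [reg10] are picked by [epsilon], independently for each
    argument, so the differential equation relating [a w] to [w] cannot be read off them. The
    analysis is therefore done on an explicit function [Li_ext] of words, and only its being a
    character identifies it with [Li]. That property is itself analytic: the defect of
    multiplicativity has derivative 0 by induction, and it tends to 0 at the origin because a word
    containing [xi1] gives a function of size |z| up to logarithms. Powers of [xi0] alone do not
    vanish there and are settled by a binomial identity.

    The only complex analysis required is a primitive on a star-shaped domain, obtained by
    differentiating the integral of h(sz) over s in [0,1]; no contour deformation occurs.

    Elements of S are lists with possible repetitions. They are compared by applying all linear
    functionals, which turns each identity between shuffles into an identity in C. *)

Definition near (z : C) (P : C -> Prop) : Prop :=
  exists d : R, (0 < d)%R /\ forall y, (Cmod (y - z) < d)%R -> P y.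

Definition ccont (f : C -> C) (z : C) : Prop :=
  forall eps : R, (0 < eps)%R -> near z (fun y => (Cmod (f y - f z) < eps)%R).

(* Caratheodory's form of differentiability, for which the product rule is an
   algebraic identity. *)
Definition cder (f : C -> C) (z l : C) : Prop :=
  exists phi : C -> C, phi z = l /\ ccont phi z /\
    near z (fun y => f y = f z + phi y * (y - z)).

Lemma near_and z P Q : near z P -> near z Q -> near z (fun y => P y /\ Q y).
Proof.
intros [d [hd h]] [d' [hd' h']]; exists (Rmin d d'); split.
- now apply Rmin_pos.
- intros y hy; split; [apply h | apply h'].
  + eapply Rlt_le_trans; [exact hy | apply Rmin_l].
  + eapply Rlt_le_trans; [exact hy | apply Rmin_r].
Qed.

Lemma near_imp z (P Q : C -> Prop) : (forall y, P y -> Q y) -> near z P -> near z Q.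
Proof. intros hPQ [d [hd h]]; exists d; split; auto. Qed.

Lemma near_ball z r : (0 < r)%R -> near z (fun y => (Cmod (y - z) < r)%R).
Proof. now exists r. Qed.

Lemma near_self z P : near z P -> P z.
Proof.
intros [d [hd h]]; apply h.
replace (z - z) with (RtoC 0) by ring; rewrite Cmod_0; exact hd.
Qed.

Lemma ccont_const c z : ccont (fun _ => c) z.
Proof.
intros e he; exists 1%R; split; [lra | intros y _].
replace (c - c) with (RtoC 0) by ring; rewrite Cmod_0; exact he.
Qed.

Lemma ccont_id z : ccont (fun y => y) z.
Proof. intros e he; now apply near_ball. Qed.

Lemma ccont_ext f g z : near z (fun y => f y = g y) -> ccont f z -> ccont g z.
Proof.
intros h hf e he; pose proof (near_self _ _ h) as hz; simpl in hz.
eapply near_imp; [|exact (near_and _ _ _ h (hf e he))].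
now intros y [<- hy]; rewrite <- hz.
Qed.

Lemma ccont_plus f g z : ccont f z -> ccont g z -> ccont (fun y => f y + g y) z.
Proof.
intros hf hg e he.
eapply near_imp;
  [|exact (near_and _ _ _ (hf (e / 2)%R ltac:(lra)) (hg (e / 2)%R ltac:(lra)))].
intros y [h1 h2].
replace (f y + g y - (f z + g z)) with ((f y - f z) + (g y - g z)) by ring.
eapply Rle_lt_trans; [apply Cmod_triangle | lra].
Qed.

Lemma ccont_mult f g z : ccont f z -> ccont g z -> ccont (fun y => f y * g y) z.
Proof.
intros hf hg e he.
set (K := (1 + Cmod (f z) + Cmod (g z))%R).
assert (hK : (0 < K)%R)
  by (unfold K; pose proof (Cmod_ge_0 (f z)); pose proof (Cmod_ge_0 (g z)); lra).
set (d := Rmin 1 (e / (2 * K))).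
assert (hd : (0 < d)%R) by (apply Rmin_pos; [lra | apply Rdiv_lt_0_compat; lra]).
assert (hdK : (d * K <= e / 2)%R).
{ apply Rle_trans with (e / (2 * K) * K)%R.
  - apply Rmult_le_compat_r; [lra | apply Rmin_r].
  - right; field; lra. }
assert (hd1 : (d <= 1)%R) by apply Rmin_l.
eapply near_imp; [|exact (near_and _ _ _ (hf d hd) (hg d hd))].
intros y [h1 h2].
replace (f y * g y - f z * g z) with
  ((f y - f z) * (g y - g z) + ((f y - f z) * g z + f z * (g y - g z))) by ring.
eapply Rle_lt_trans; [apply Cmod_triangle|].
eapply Rle_lt_trans; [apply Rplus_le_compat_l, Cmod_triangle|].
rewrite !Cmod_mult.
pose proof (Cmod_ge_0 (f z)); pose proof (Cmod_ge_0 (g z)).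
pose proof (Cmod_ge_0 (f y - f z)); pose proof (Cmod_ge_0 (g y - g z)).
unfold K in hdK; nra.
Qed.

Lemma Cmod_triangle_rev (a b : C) : (Cmod a - Cmod b <= Cmod (a - b))%R.
Proof.
pose proof (Cmod_triangle (a - b) b) as h.
replace (a - b + b) with a in h by ring; lra.
Qed.

Lemma Cmod_minus_sym (a b : C) : Cmod (a - b) = Cmod (b - a).
Proof. replace (a - b) with (- (b - a)) by ring; apply Cmod_opp. Qed.

Lemma near_neq_0 (z : C) : z <> 0 -> near z (fun y => y <> 0).
Proof.
intros hz; exists (Cmod z); split; [exact (proj1 (Cmod_gt_0 z) hz)|].
intros y hy ->; rewrite Cmod_minus_sym in hy.
replace (z - 0) with z in hy by ring; lra.
Qed.

Lemma ccont_inv (z : C) : z <> 0 -> ccont (fun y => / y) z.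
Proof.
intros hz e he; pose proof (proj1 (Cmod_gt_0 z) hz) as hm.
set (m := Cmod z) in *.
set (d := Rmin (m / 2) (e * (m * m) / 2)).
assert (hd : (0 < d)%R).
{ apply Rmin_pos; [lra|]; apply Rdiv_lt_0_compat; [|lra].
  apply Rmult_lt_0_compat; nra. }
assert (d1 : (d <= m / 2)%R) by apply Rmin_l.
assert (d2 : (d <= e * (m * m) / 2)%R) by apply Rmin_r.
exists d; split; [exact hd | intros y hy].
assert (hy2 : (m / 2 < Cmod y)%R).
{ pose proof (Cmod_triangle_rev z y) as h; rewrite Cmod_minus_sym in h; fold m in h; lra. }
assert (hy0 : y <> 0) by (apply (proj2 (Cmod_gt_0 y)); lra).
replace (/ y - / z) with ((z - y) / (y * z)) by (field; split; assumption).
rewrite Cmod_div by now apply Cmult_neq_0.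
rewrite Cmod_mult, Cmod_minus_sym; fold m.
apply Rlt_div_l; [nra|].
apply Rlt_le_trans with d; [exact hy|]; nra.
Qed.

Lemma ccont_comp f g z : ccont g z -> ccont f (g z) -> ccont (fun y => f (g y)) z.
Proof.
intros hg hf e he; destruct (hf e he) as [d [hd h]].
eapply near_imp; [|exact (hg d hd)]; auto.
Qed.

Lemma ccont_opp f z : ccont f z -> ccont (fun y => - f y) z.
Proof.
intros hf; apply ccont_ext with (fun y => - (1) * f y).
- exists 1%R; split; [lra | intros; cbv beta; ring].
- apply ccont_mult; [apply ccont_const | exact hf].
Qed.

Lemma cder_cont f z l : cder f z l -> ccont f z.
Proof.
intros [phi [_ [hc h]]].
apply ccont_ext with (fun y => f z + phi y * (y - z)).
- eapply near_imp; [|exact h]; now intros y ->.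
- apply ccont_plus; [apply ccont_const|].
  apply ccont_mult; [exact hc|].
  apply ccont_plus; [apply ccont_id | apply ccont_const].
Qed.

Lemma cder_ext f g z l : near z (fun y => f y = g y) -> cder f z l -> cder g z l.
Proof.
intros h [phi [h0 [hc hf]]]; exists phi; split; [exact h0 | split; [exact hc|]].
pose proof (near_self _ _ h) as hz; simpl in hz.
eapply near_imp; [|exact (near_and _ _ _ h hf)].
now intros y [<- hy]; rewrite <- hz.
Qed.

Lemma cder_eq f z l l' : cder f z l -> l = l' -> cder f z l'.
Proof. now intros h <-. Qed.

Lemma cder_const c z : cder (fun _ => c) z 0.
Proof.
exists (fun _ => 0); repeat split; [apply ccont_const|].
exists 1%R; split; [lra | intros; cbv beta; ring].
Qed.

Lemma cder_id z : cder (fun y => y) z 1.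
Proof.
exists (fun _ => 1); repeat split; [apply ccont_const|].
exists 1%R; split; [lra | intros; cbv beta; ring].
Qed.

Lemma cder_plus f g z l m :
  cder f z l -> cder g z m -> cder (fun y => f y + g y) z (l + m).
Proof.
intros [p [<- [hp hf]]] [q [<- [hq hg]]].
exists (fun y => p y + q y); repeat split; [now apply ccont_plus|].
eapply near_imp; [|exact (near_and _ _ _ hf hg)].
intros y [-> ->]; cbv beta; ring.
Qed.

Lemma cder_mult f g z l m :
  cder f z l -> cder g z m -> cder (fun y => f y * g y) z (l * g z + f z * m).
Proof.
intros hf0 hg0; pose proof (cder_cont _ _ _ hg0) as hgc.
destruct hf0 as [p [<- [hp hf]]], hg0 as [q [<- [hq hg]]].
exists (fun y => p y * g y + f z * q y); repeat split.
- apply ccont_plus; apply ccont_mult; auto using ccont_const.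
- eapply near_imp; [|exact (near_and _ _ _ hf hg)].
  intros y [-> ->]; cbv beta; ring.
Qed.

Lemma cder_scal c f z l : cder f z l -> cder (fun y => c * f y) z (c * l).
Proof.
intros h; eapply cder_eq.
- exact (cder_mult _ _ _ _ _ (cder_const c z) h).
- cbv beta; ring.
Qed.

Lemma cder_inv (z : C) : z <> 0 -> cder (fun y => / y) z (- / (z * z)).
Proof.
intros hz; exists (fun y => - / (y * z)); repeat split.
- apply ccont_opp, (ccont_comp (fun y => / y)).
  + apply ccont_mult; [apply ccont_id | apply ccont_const].
  + apply ccont_inv; now apply Cmult_neq_0.
- eapply near_imp; [|exact (near_neq_0 z hz)].
  intros y hy; field; auto.
Qed.

Lemma cder_comp f g z l m :
  cder g z l -> cder f (g z) m -> cder (fun y => f (g y)) z (m * l).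
Proof.
intros hg0 hf0; pose proof (cder_cont _ _ _ hg0) as hgc.
destruct hg0 as [q [<- [hq hg]]], hf0 as [p [<- [hp [d [hd hf]]]]].
exists (fun y => p (g y) * q y); repeat split.
- apply ccont_mult; [now apply (ccont_comp p) | exact hq].
- eapply near_imp; [|exact (near_and _ _ _ hg (hgc d hd))].
  intros y [h1 h2]; rewrite (hf (g y) h2).
  replace (g y - g z) with (q y * (y - z)) by (rewrite h1; ring); ring.
Qed.

Lemma cder_1_minus z : cder (fun y => 1 - y) z (- (1)).
Proof.
exists (fun _ => - (1)); repeat split; [apply ccont_const|].
exists 1%R; split; [lra | intros; cbv beta; ring].
Qed.

(** The difference quotient, patched with the value [l] at [z] by excluded middle, is a Caratheodory
    factor; the little-o estimate is exactly its continuity at [z]. *)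
Lemma cder_eps f z l :
  (forall eps, (0 < eps)%R ->
     near z (fun y => (Cmod (f y - f z - l * (y - z)) <= eps * Cmod (y - z))%R)) ->
  cder f z l.
Proof.
intros h.
exists (fun y => if excluded_middle_informative (y = z) then l
                 else (f y - f z) / (y - z)).
assert (hz : forall y, y <> z -> y - z <> 0)
  by (intros y hy e; apply hy; replace y with (y - z + z) by ring; rewrite e; ring).
repeat split.
- now destruct (excluded_middle_informative (z = z)).
- intros e he; eapply near_imp; [|exact (h (e / 2)%R ltac:(lra))].
  intros y hy.
  destruct (excluded_middle_informative (z = z)) as [_|n]; [|now destruct n].
  destruct (excluded_middle_informative (y = z)) as [->|n].
  + replace (l - l) with (RtoC 0) by ring; rewrite Cmod_0; exact he.
  + replace ((f y - f z) / (y - z) - l) with ((f y - f z - l * (y - z)) / (y - z))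
      by (field; auto).
    rewrite Cmod_div by auto.
    pose proof (proj1 (Cmod_gt_0 _) (hz y n)).
    apply Rlt_div_l; [lra | nra].
- exists 1%R; split; [lra | intros y _].
  destruct (excluded_middle_informative (y = z)) as [->|n]; [ring|].
  field; auto.
Qed.

Lemma cder_small f z l : cder f z l ->
  forall eps, (0 < eps)%R ->
     near z (fun y => (Cmod (f y - f z - l * (y - z)) <= eps * Cmod (y - z))%R).
Proof.
intros [phi [<- [hc hf]]] e he.
eapply near_imp; [|exact (near_and _ _ _ hf (hc e he))].
intros y [-> hy].
replace (f z + phi y * (y - z) - f z - phi z * (y - z))
  with ((phi y - phi z) * (y - z)) by ring.
rewrite Cmod_mult; apply Rmult_le_compat_r; [apply Cmod_ge_0 | lra].
Qed.

Lemma Cmod_norm (z : C) : norm (V := C_R_NormedModule) z = Cmod z.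
Proof.
destruct z as [x y]; unfold norm, Cmod; simpl; unfold prod_norm; simpl.
unfold norm; simpl; unfold abs; simpl.
rewrite !Rmult_1_r, <- !Rabs_mult, !Rabs_pos_eq by nra; reflexivity.
Qed.

(** The bridge to real calculus: along a line, a complex derivative becomes a derivative in one real
    variable, to which the fundamental theorem of calculus applies. *)
Lemma is_derive_line f (a d : C) (s : R) (l : C) :
  cder f (a + s * d) l ->
  is_derive (V := C_R_NormedModule) (fun s : R => f (a + s * d)) s (l * d).
Proof.
intros h; split; [apply is_linear_scal_l|].
intros x hx; assert (x = s) as -> by (symmetry; now apply is_filter_lim_locally_unique).
intros eps.
(* The summand 1 keeps [K] positive when the direction [d] is 0. *)
set (K := (1 + Cmod d)%R).
assert (hK : (0 < K)%R) by (unfold K; pose proof (Cmod_ge_0 d); lra).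
destruct (cder_small _ _ _ h (eps / K)%R) as [r [hr hn]].
{ apply Rdiv_lt_0_compat; [apply cond_pos | exact hK]. }
assert (hrK : (0 < r / K)%R) by (apply Rdiv_lt_0_compat; assumption).
exists (mkposreal _ hrK); intros t ht.
change (Rabs (t - s) < r / K)%R in ht.
assert (e1 : (a + t * d) - (a + s * d) = RtoC (t - s) * d)
  by (rewrite RtoC_minus; ring).
assert (hd : (Cmod ((a + t * d) - (a + s * d)) <= Rabs (t - s) * K)%R).
{ rewrite e1, Cmod_mult, Cmod_R.
  apply Rmult_le_compat_l; [apply Rabs_pos | unfold K; lra]. }
specialize (hn (a + t * d)).
assert (hlt : (Cmod ((a + t * d) - (a + s * d)) < r)%R).
{ eapply Rle_lt_trans; [exact hd|].
  apply (Rmult_lt_compat_r K) in ht; [|exact hK].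
  now replace (r / K * K)%R with r in ht by (field; lra). }
specialize (hn hlt); rewrite Cmod_norm.
change (norm (minus t s)) with (Rabs (t - s)).
apply Rle_trans with
  (Cmod (f (a + t * d) - f (a + s * d) - l * ((a + t * d) - (a + s * d)))).
- right; apply (f_equal Cmod); rewrite e1.
  set (u := f (a + t * d)); set (v := f (a + s * d)); clearbody u v.
  clear; destruct u, v, l, d.
  unfold minus, plus, opp, scal; simpl; unfold prod_plus, prod_opp, prod_scal; simpl.
  unfold plus, opp, scal; simpl; unfold mult; simpl.
  unfold Cminus, Cplus, Copp, Cmult, RtoC; simpl; f_equal; ring.
- eapply Rle_trans; [exact hn|].
  apply Rle_trans with (eps / K * (Rabs (t - s) * K))%R.
  + apply Rmult_le_compat_l; [|exact hd].
    apply Rlt_le, Rdiv_lt_0_compat; [apply cond_pos | exact hK].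
  + right; field; lra.
Qed.

(** * Primitives on the slit plane *)

Notation is_CInt f l := (is_RInt (V := C_R_NormedModule) f 0 1 l).

Definition CInt (f : R -> C) : C := RInt (V := C_R_CompleteNormedModule) f 0 1.

(** [z * mean h z] is the integral of [h] over the segment from 0 to [z]. Keeping the factor [z]
    apart lets it cancel the pole of dz/z in the next integration. *)
Definition mean (h : C -> C) (z : C) : C := CInt (fun s => h (s * z)).

Lemma continuous_of_ccont F (s : R) :
  ccont F s -> continuous (U := C_R_NormedModule) (fun s : R => F (RtoC s)) s.
Proof.
intros h P [e he]; destruct (h e (cond_pos e)) as [d [hd hn]].
exists (mkposreal d hd); intros t ht.
apply he, C_NormedModule_mixin_compat1; change (Cmod (F t - F s) < e)%R.
apply hn; change (Rabs (t - s) < d)%R in ht.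
now rewrite <- RtoC_minus, Cmod_R.
Qed.

Lemma CInt_ftc (F F' : C -> C) :
  (forall s : R, (0 <= s <= 1)%R -> cder F s (F' s) /\ ccont F' s) ->
  is_CInt (fun s => F' (RtoC s)) (F 1 - F 0).
Proof.
intros h.
apply (is_RInt_derive (V := C_R_CompleteNormedModule) (fun s : R => F (RtoC s))).
- intros s hs; rewrite Rmin_left, Rmax_right in hs by lra.
  apply is_derive_ext with (fun s : R => F (0 + s * 1)).
  { intros t; f_equal; ring. }
  replace (F' s) with (F' s * 1) by ring.
  apply is_derive_line; replace (0 + s * 1) with (RtoC s) by ring; now apply h.
- intros s hs; rewrite Rmin_left, Rmax_right in hs by lra.
  apply continuous_of_ccont; now apply h.
Qed.

Lemma CInt_correct (F : C -> C) :
  (forall s : R, (0 <= s <= 1)%R -> ccont F s) ->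
  is_CInt (fun s => F (RtoC s)) (CInt (fun s => F (RtoC s))).
Proof.
intros h; apply (RInt_correct (V := C_R_CompleteNormedModule)).
apply ex_RInt_continuous; intros s hs.
rewrite Rmin_left, Rmax_right in hs by lra.
apply continuous_of_ccont; now apply h.
Qed.

Lemma CInt_unique f l : is_CInt f l -> CInt f = l.
Proof. exact (is_RInt_unique (V := C_R_CompleteNormedModule) f 0 1 l). Qed.

Lemma CInt_ext (f g : R -> C) :
  (forall s : R, (0 < s < 1)%R -> f s = g s) -> CInt f = CInt g.
Proof.
intros h; refine (RInt_ext (V := C_R_CompleteNormedModule) f g 0 1 _).
intros s hs; rewrite Rmin_left, Rmax_right in hs by lra; exact (h s hs).
Qed.

Lemma is_CInt_unique f l m : is_CInt f l -> is_CInt f m -> l = m.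
Proof. intros h1 h2; now rewrite <- (CInt_unique _ _ h1), (CInt_unique _ _ h2). Qed.

Lemma is_CInt_bound f l M :
  is_CInt f l -> (forall s : R, (0 <= s <= 1)%R -> (Cmod (f s) <= M)%R) ->
  (Cmod l <= M)%R.
Proof.
intros h hM; rewrite <- Cmod_norm; replace M with ((1 - 0) * M)%R by ring.
apply (norm_RInt_le_const f 0 1); [lra | | exact h].
intros s hs; rewrite Cmod_norm; auto.
Qed.

Lemma is_CInt_ext f g l :
  (forall s : R, f s = g s) -> is_CInt f l -> is_CInt g l.
Proof. intros h; apply is_RInt_ext; auto. Qed.

Lemma is_CInt_plus f g l m :
  is_CInt f l -> is_CInt g m -> is_CInt (fun s => f s + g s) (l + m).
Proof. exact (is_RInt_plus (V := C_R_NormedModule) f g 0 1 l m). Qed.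

Lemma is_CInt_minus f g l m :
  is_CInt f l -> is_CInt g m -> is_CInt (fun s => f s - g s) (l - m).
Proof. exact (is_RInt_minus (V := C_R_NormedModule) f g 0 1 l m). Qed.

Lemma is_CInt_const c : is_CInt (fun _ => c) c.
Proof.
pose proof (is_RInt_const (V := C_R_NormedModule) 0 1 c) as h.
replace (1 - 0)%R with 1%R in h by ring.
now rewrite (scal_one (V := C_R_NormedModule) c : scal 1%R c = c) in h.
Qed.

(** The integral takes values in C as a real normed module, so a complex factor is treated on real
    and imaginary parts. *)
Lemma is_CInt_scal c f l : is_CInt f l -> is_CInt (fun s => c * f s) (c * l).
Proof.
intros h; destruct c as [p q], l as [u v].
pose proof (is_RInt_fct_extend_fst f 0 1 _ h) as h1.
pose proof (is_RInt_fct_extend_snd f 0 1 _ h) as h2; simpl in h1, h2.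
apply (is_RInt_fct_extend_pair (U := R_NormedModule) (V := R_NormedModule)); simpl.
- apply (is_RInt_minus (V := R_NormedModule));
    now apply (is_RInt_scal (V := R_NormedModule)).
- apply (is_RInt_plus (V := R_NormedModule));
    now apply (is_RInt_scal (V := R_NormedModule)).
Qed.

Lemma D0_iff z : D0 z <-> (Im z <> 0%R \/ (Re z < 1)%R).
Proof.
unfold D0; split.
- intros h; destruct (Req_dec (Im z) 0) as [e|n]; [right | now left].
  apply Rnot_le_lt; intros h1; now apply h.
- intros [h|h] [h1 h2]; [easy | lra].
Qed.

Lemma Re_le_Cmod z : (Rabs (Re z) <= Cmod z)%R.
Proof. eapply Rle_trans; [apply Rmax_l | apply Rmax_Cmod]. Qed.

Lemma Im_le_Cmod z : (Rabs (Im z) <= Cmod z)%R.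
Proof. eapply Rle_trans; [apply Rmax_r | apply Rmax_Cmod]. Qed.

Lemma D0_near z : D0 z -> near z D0.
Proof.
intros h; apply D0_iff in h; destruct h as [h|h].
- exists (Rabs (Im z)); split; [now apply Rabs_pos_lt|].
  intros y hy; apply D0_iff; left; intros e.
  pose proof (Im_le_Cmod (y - z)) as hi.
  replace (Im (y - z)) with (- Im z)%R in hi
    by (destruct y, z; simpl in *; lra).
  rewrite Rabs_Ropp in hi; lra.
- exists (1 - Re z)%R; split; [lra|].
  intros y hy; apply D0_iff; right.
  pose proof (Re_le_Cmod (y - z)) as hi.
  replace (Re (y - z)) with (Re y - Re z)%R in hi
    by (destruct y, z; simpl in *; lra).
  pose proof (Rle_abs (Re y - Re z)); lra.
Qed.

(** Star-shapedness about 0, which is why straight segments suffice as paths. *)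
Lemma D0_scal (s : R) z : (0 <= s <= 1)%R -> D0 z -> D0 (s * z).
Proof.
intros hs h; apply D0_iff in h; apply D0_iff.
destruct z as [x y]; simpl in *.
destruct (Req_dec s 0) as [->|hs0]; [right; lra|].
destruct h as [h|h]; [left | right; nra].
intros e; apply h; apply Rmult_eq_reg_l with s; lra.
Qed.

(** Continuity of the derivative belongs to the notion: it permits integrating [h'] along segments
    and differentiating under the integral sign. *)
Definition C1 (h h' : C -> C) : Prop :=
  forall z, D0 z -> cder h z (h' z) /\ ccont h' z.

(** Compactness of [0,1], applied to a gauge that assigns to each [s] a radius of continuity of [k]
    at [s * z]. *)
Lemma ccont_segment_unif k z :
  (forall s : R, (0 <= s <= 1)%R -> ccont k (s * z)%C) ->
  forall eps, (0 < eps)%R -> exists d, (0 < d)%R /\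
    forall (s : R) y, (0 <= s <= 1)%R -> (Cmod (y - s * z) < d)%R ->
      (Cmod (k y - k (s * z)%C) < eps)%R.
Proof.
intros hk e he.
(* The two summands absorb the two moves of the final estimate, from [y] to [s * z] and from [s * z]
   to [t * z], where [t] is the point whose gauge is used. *)
set (K := (1 + Cmod z)%R).
assert (hK : (0 < K)%R) by (unfold K; pose proof (Cmod_ge_0 z); lra).
assert (hd : forall s : R, exists d : posreal, (0 <= s <= 1)%R ->
  forall y, (Cmod (y - s * z) < d * K)%R -> (Cmod (k y - k (s * z)%C) < e / 2)%R).
{ intros s; destruct (excluded_middle_informative (0 <= s <= 1)%R) as [h|h].
  - destruct (hk s h (e / 2)%R ltac:(lra)) as [d [hd hn]].
    assert (hdK : (0 < d / K)%R) by (apply Rdiv_lt_0_compat; assumption).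
    exists (mkposreal _ hdK); intros _ y hy; apply hn; simpl in hy.
    now replace (d / K * K)%R with d in hy by (field; lra).
  - exists (mkposreal 1 ltac:(lra)); intros h'; now destruct h. }
set (del := fun s => proj1_sig (constructive_indefinite_description _ (hd s))).
destruct (compactness_value_1d 0 1 del) as [d hc].
exists d; split; [apply cond_pos|].
intros s y hs hy.
(* Compactness delivers the point [t] only under a double negation, hence the argument by
   contradiction. *)
apply Rnot_le_lt; intros hcontra; apply (hc s hs).
intros [t [ht [h1 h2]]].
unfold del in h1, h2.
destruct (constructive_indefinite_description _ (hd t)) as [dt hdt]; simpl in *.
specialize (hdt ht).
assert (hst : (Cmod (s * z - t * z) <= Rabs (s - t) * Cmod z)%R).
{ replace (s * z - t * z) with (RtoC (s - t) * z) by (rewrite RtoC_minus; ring).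
  rewrite Cmod_mult, Cmod_R; lra. }
pose proof (Cmod_ge_0 z) as hz.
assert (hst' : (Cmod (s * z - t * z) <= dt * Cmod z)%R)
  by (eapply Rle_trans; [exact hst | apply Rmult_le_compat_r; lra]).
pose proof (cond_pos dt).
pose proof (hdt (s * z)) as a1; pose proof (hdt y) as a2.
assert (hyt : (Cmod (y - t * z) <= Cmod (y - s * z) + Cmod (s * z - t * z))%R).
{ replace (y - t * z) with ((y - s * z) + (s * z - t * z)) by ring.
  apply Cmod_triangle. }
assert (b1 := a1 ltac:(unfold K; lra)).
assert (b2 := a2 ltac:(unfold K; lra)).
assert (hf : (Cmod (k y - k (s * z)%C) <=
  Cmod (k y - k (t * z)%C) + Cmod (k (s * z)%C - k (t * z)%C))%R).
{ rewrite (Cmod_minus_sym (k (s * z)%C)).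
  replace (k y - k (s * z)%C) with ((k y - k (t * z)%C) + (k (t * z)%C - k (s * z)%C)) by ring.
  apply Cmod_triangle. }
lra.
Qed.

(** The left-hand side is the integral of (h' - l)(b - a) over the segment from [a] to [b]. *)
Lemma mean_value_ineq h h' a b l e :
  (forall r : R, (0 <= r <= 1)%R ->
     cder h (a + r * (b - a)) (h' (a + r * (b - a))%C) /\
     ccont h' (a + r * (b - a))%C /\
     (Cmod (h' (a + r * (b - a))%C - l) <= e)%R) ->
  (Cmod (h b - h a - l * (b - a)) <= e * Cmod (b - a))%R.
Proof.
intros H.
assert (hg : forall r : C, cder (fun r => a + r * (b - a)) r (b - a)).
{ intros r; eapply cder_eq.
  - apply cder_plus; [apply cder_const|].
    apply cder_mult; [apply cder_id | apply cder_const].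
  - cbv beta; ring. }
assert (hi : is_CInt (fun r => h' (a + r * (b - a))%C * (b - a)) (h b - h a)).
{ replace (h b - h a) with
    ((fun r => h (a + r * (b - a))) 1 - (fun r => h (a + r * (b - a))) 0)
    by (cbv beta; do 2 f_equal; [f_equal; ring | f_equal; ring]).
  apply (CInt_ftc (fun r => h (a + r * (b - a)))
                  (fun r => h' (a + r * (b - a))%C * (b - a))).
  intros r hr; destruct (H r hr) as [h1 [h2 _]]; split.
  - exact (cder_comp h (fun r => a + r * (b - a)) _ _ _ (hg r) h1).
  - apply ccont_mult; [|apply ccont_const].
    apply (ccont_comp h'); [exact (cder_cont _ _ _ (hg r)) | exact h2]. }
pose proof (is_CInt_minus _ _ _ _ hi (is_CInt_const (l * (b - a)))) as hm.
eapply is_CInt_bound; [exact hm|].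
intros r hr; cbv beta.
replace (h' (a + r * (b - a))%C * (b - a) - l * (b - a))
  with ((h' (a + r * (b - a))%C - l) * (b - a)) by ring.
rewrite Cmod_mult; apply Rmult_le_compat_r; [apply Cmod_ge_0 | now apply H].
Qed.

Lemma ccont_ray k z (s : C) : ccont k (s * z)%C -> ccont (fun s => k (s * z)%C) s.
Proof.
intros h; apply (ccont_comp k); [|exact h].
apply ccont_mult; [apply ccont_id | apply ccont_const].
Qed.

Lemma cder_ray h z (s l : C) : cder h (s * z) l -> cder (fun s => h (s * z)) s (l * z).
Proof.
intros hh; apply (cder_comp h (fun s => s * z)); [|exact hh].
eapply cder_eq; [apply cder_mult; [apply cder_id | apply cder_const] | cbv beta; ring].
Qed.

Lemma is_CInt_ray k z :
  (forall z, D0 z -> ccont k z) -> D0 z ->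
  is_CInt (fun s : R => k (s * z)%C) (mean k z) /\
  is_CInt (fun s : R => s * k (s * z)%C) (CInt (fun s : R => s * k (s * z)%C)).
Proof.
intros hk hz; split.
- apply (CInt_correct (fun s => k (s * z)%C)).
  intros s hs; apply ccont_ray, hk; now apply D0_scal.
- apply (CInt_correct (fun s => s * k (s * z)%C)).
  intros s hs; apply ccont_mult; [apply ccont_id|].
  apply ccont_ray, hk; now apply D0_scal.
Qed.

(** Differentiation under the integral sign. The error of the linear approximation of [mean h] is
    the mean of the errors along the ray, and each of these is bounded by the mean value inequality,
    uniformly in [s] by [ccont_segment_unif]. *)
Lemma mean_C1 h h' :
  C1 h h' -> C1 (mean h) (fun z => CInt (fun s : R => s * h' (s * z)%C)).
Proof.
intros hC z hz.
assert (hch : forall z, D0 z -> ccont h z)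
  by (intros y hy; exact (cder_cont _ _ _ (proj1 (hC y hy)))).
assert (hch' : forall z, D0 z -> ccont h' z) by (intros y hy; apply (hC y hy)).
assert (hu := fun eps he => ccont_segment_unif h' z
  (fun s hs => hch' _ (D0_scal s z hs hz)) eps he).
assert (hsc : forall (s : R) (y x : C), (0 <= s <= 1)%R ->
  (Cmod (s * y - s * x) <= Cmod (y - x))%R).
{ intros s y x hs; replace (s * y - s * x) with (s * (y - x)) by ring.
  rewrite Cmod_mult, Cmod_R, Rabs_pos_eq by lra.
  pose proof (Cmod_ge_0 (y - x)); nra. }
destruct (D0_near z hz) as [r [hr hD]].
split.
- apply cder_eps; intros e he.
  destruct (hu e he) as [d [hd hn]].
  exists (Rmin r d); split; [now apply Rmin_pos|].
  intros y hy.
  assert (hyr : (Cmod (y - z) < r)%R) by (eapply Rlt_le_trans; [exact hy | apply Rmin_l]).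
  assert (hyd : (Cmod (y - z) < d)%R) by (eapply Rlt_le_trans; [exact hy | apply Rmin_r]).
  assert (hyD : D0 y) by auto.
  pose proof (is_CInt_minus _ _ _ _
    (is_CInt_minus _ _ _ _ (proj1 (is_CInt_ray h y hch hyD))
                           (proj1 (is_CInt_ray h z hch hz)))
    (is_CInt_scal (y - z) _ _ (proj2 (is_CInt_ray h' z hch' hz)))) as hi.
  rewrite (Cmult_comm (CInt _)).
  eapply is_CInt_bound; [exact hi|]; intros s hs; cbv beta.
  replace (h (s * y) - h (s * z) - (y - z) * (s * h' (s * z)%C))
    with (h (s * y) - h (s * z) - h' (s * z)%C * (s * y - s * z)) by ring.
  apply Rle_trans with (e * Cmod (s * y - s * z))%R;
    [|apply Rmult_le_compat_l; [lra | now apply hsc]].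
  apply mean_value_ineq with h'; intros t ht.
  (* A point between [s * z] and [s * y] is [s] times a point of the ball about [z], hence lies in
     [D0]. *)
  replace (s * z + t * (s * y - s * z)) with (s * (z + t * (y - z))) by ring.
  assert (hp : (Cmod (z + t * (y - z) - z) <= Cmod (y - z))%R).
  { replace (z + t * (y - z) - z) with (t * y - t * z) by ring; now apply hsc. }
  assert (hpD : D0 (s * (z + t * (y - z)))) by (apply D0_scal; [exact hs | apply hD; lra]).
  split; [now apply hC | split; [now apply hC|]].
  apply Rlt_le, hn; [exact hs|].
  eapply Rle_lt_trans; [now apply hsc | lra].
- intros e he; destruct (hu (e / 2)%R ltac:(lra)) as [d [hd hn]].
  exists (Rmin r d); split; [now apply Rmin_pos|].
  intros y hy.
  assert (hyr : (Cmod (y - z) < r)%R) by (eapply Rlt_le_trans; [exact hy | apply Rmin_l]).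
  assert (hyd : (Cmod (y - z) < d)%R) by (eapply Rlt_le_trans; [exact hy | apply Rmin_r]).
  apply Rle_lt_trans with (e / 2)%R; [|lra].
  eapply is_CInt_bound.
  + apply is_CInt_minus; apply is_CInt_ray; auto.
  + intros s hs; cbv beta.
    replace (s * h' (s * y)%C - s * h' (s * z)%C) with (s * (h' (s * y)%C - h' (s * z)%C)) by ring.
    rewrite Cmod_mult, Cmod_R, Rabs_pos_eq by lra.
    assert (hlt : (Cmod (h' (s * y)%C - h' (s * z)%C) < e / 2)%R).
    { apply hn; [exact hs|]; eapply Rle_lt_trans; [now apply hsc | lra]. }
    pose proof (Cmod_ge_0 (h' (s * y)%C - h' (s * z)%C)); nra.
Qed.

(** The product rule gives the integral of h(sz) + s z h'(sz), which is the s-derivative of s h(sz);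
    its integral over [0,1] is h(z). *)
Lemma mean_primitive h h' z :
  C1 h h' -> D0 z -> cder (fun z => z * mean h z) z (h z).
Proof.
intros hC hz.
assert (hch : forall z, D0 z -> ccont h z)
  by (intros y hy; exact (cder_cont _ _ _ (proj1 (hC y hy)))).
assert (hch' : forall z, D0 z -> ccont h' z) by (intros y hy; apply (hC y hy)).
eapply cder_eq.
- apply cder_mult; [apply cder_id | exact (proj1 (mean_C1 h h' hC z hz))].
- assert (hi : is_CInt (fun s : R => 1 * h (s * z) + s * (h' (s * z)%C * z))
    (1 * h (1 * z) - 0 * h (0 * z))).
  { apply (CInt_ftc (fun s => s * h (s * z))
      (fun s => 1 * h (s * z) + s * (h' (s * z)%C * z))).
    intros s hs; pose proof (D0_scal s z hs hz) as hsz; split.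
    - apply (cder_mult (fun s => s) (fun s => h (s * z))); [apply cder_id|].
      apply cder_ray; now apply hC.
    - apply ccont_plus; apply ccont_mult;
        [apply ccont_const | apply ccont_ray; auto | apply ccont_id |].
      apply ccont_mult; [apply ccont_ray; auto | apply ccont_const]. }
  replace (1 * h (1 * z) - 0 * h (0 * z)) with (h z) in hi
    by (rewrite (Cmult_1_l z); ring).
  apply (is_CInt_unique _ _ _) with (2 := hi).
  pose proof (is_CInt_plus _ _ _ _
    (is_CInt_scal 1 _ _ (proj1 (is_CInt_ray h z hch hz)))
    (is_CInt_scal z _ _ (proj2 (is_CInt_ray h' z hch' hz)))) as hp.
  revert hp; apply is_CInt_ext; intros s.
  lazymatch goal with |- ?a = ?b => change (@eq C a b) end; ring.
Qed.

(** * Iterated integrals and the logarithm *)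

Lemma C1_cont h h' z : C1 h h' -> D0 z -> ccont h z.
Proof. intros hC hz; exact (cder_cont _ _ _ (proj1 (hC z hz))). Qed.

Lemma C1_mult h h' g g' :
  C1 h h' -> C1 g g' ->
  C1 (fun z => h z * g z) (fun z => h' z * g z + h z * g' z).
Proof.
intros hh hg z hz; split.
- apply cder_mult; [now apply hh | now apply hg].
- apply ccont_plus; apply ccont_mult;
    solve [now apply hh | now apply hg | now apply (C1_cont h h')
          | now apply (C1_cont g g')].
Qed.

Lemma D0_1_minus_neq_0 z : D0 z -> 1 - z <> 0.
Proof.
intros h e; apply h.
assert (z = RtoC 1) as -> by (replace z with (1 - (1 - z)) by ring; rewrite e; ring).
simpl; split; [reflexivity | lra].
Qed.

Lemma C1_inv_1_minus :
  C1 (fun z => / (1 - z)) (fun z => / ((1 - z) * (1 - z))).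
Proof.
intros z hz; pose proof (D0_1_minus_neq_0 z hz) as h; split.
- eapply cder_eq.
  + apply (cder_comp Cinv (fun z => 1 - z)); [apply cder_1_minus | now apply cder_inv].
  + cbv beta; ring.
- apply (ccont_comp Cinv (fun z => (1 - z) * (1 - z))).
  + apply ccont_mult; exact (cder_cont _ _ _ (cder_1_minus z)).
  + apply ccont_inv; now apply Cmult_neq_0.
Qed.

Lemma C1_id : C1 (fun z => z) (fun _ => RtoC 1).
Proof. intros z _; split; [apply cder_id | apply ccont_const]. Qed.

(** The extension [h] has to match the integrand only away from 0: for z <> 0 the ray meets 0 only
    at the endpoint s = 0, which the integral ignores, and for z = 0 both sides vanish. *)
Lemma Li_word_cons a w h h' :
  C1 h h' ->
  (forall t, D0 t -> t <> RtoC 0 -> h t = form a t * Li_word w t) ->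
  forall z, D0 z -> Li_word (a :: w) z = z * mean h z.
Proof.
intros hC he z hz.
assert (hc : forall z, D0 z -> ccont h z)
  by (intros y hy; exact (C1_cont h h' y hC hy)).
transitivity (CInt (fun s : R => z * h (s * z))).
- apply CInt_ext; intros s hs.
  destruct (excluded_middle_informative (z = 0)) as [->|hz0];
    [now rewrite !Cmult_0_l|].
  rewrite he; [reflexivity | apply D0_scal; [lra | exact hz]|].
  apply Cmult_neq_0; [|exact hz0].
  intros e; apply RtoC_inj in e; lra.
- apply CInt_unique.
  exact (is_CInt_scal z _ _ (proj1 (is_CInt_ray h z hc hz))).
Qed.

(* The integrands of the iterated integrals extend holomorphically through the
   origin. *)
Lemma Li_word_integrand v a w :
  a :: w = v ++ [xi1] ->
  exists h h', C1 h h' /\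
    forall t, D0 t -> t <> RtoC 0 -> h t = form a t * Li_word w t.
Proof.
revert a w; induction v as [|b v IH]; intros a w e; simpl in e.
- injection e as -> ->.
  exists (fun z => / (1 - z)), (fun z => / ((1 - z) * (1 - z))); split.
  + exact C1_inv_1_minus.
  + intros t _ _; simpl; ring.
- injection e as -> ->.
  destruct (v ++ [xi1]) as [|c w] eqn:ew; [now destruct v|].
  destruct (IH c w eq_refl) as [g [g' [hC hg]]].
  pose proof (Li_word_cons c w g g' hC hg) as hL.
  (* For [xi0], the factor t of t * [mean g t] cancels 1/t; for [xi1], the form is regular at 0 and
     the factor stays. *)
  destruct b.
  + eexists (mean g), _; split; [exact (mean_C1 g g' hC)|].
    intros t ht ht0; rewrite hL by exact ht; simpl; field; exact ht0.
  + eexists (fun z => / (1 - z) * (z * mean g z)), _; split.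
    * apply C1_mult; [exact C1_inv_1_minus|].
      apply C1_mult; [exact C1_id | exact (mean_C1 g g' hC)].
    * intros t ht ht0; rewrite hL by exact ht; reflexivity.
Qed.

(** Exhibits the zero at the origin, the source of all estimates [ord 1]. *)
Lemma Li_word_factor v : exists g,
  (forall z, D0 z -> ccont g z) /\
  forall z, D0 z -> Li_word (v ++ [xi1]) z = z * g z.
Proof.
destruct (v ++ [xi1]) as [|a w] eqn:e; [now destruct v|].
destruct (Li_word_integrand v a w (eq_sym e)) as [h [h' [hC he]]].
exists (mean h); split; [|exact (Li_word_cons a w h h' hC he)].
intros z hz; eapply C1_cont; [exact (mean_C1 h h' hC) | exact hz].
Qed.

Lemma Li_word_cder v a w z :
  a :: w = v ++ [xi1] -> D0 z -> z <> RtoC 0 ->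
  cder (Li_word (a :: w)) z (form a z * Li_word w z).
Proof.
intros e hz hz0.
destruct (Li_word_integrand v a w e) as [h [h' [hC he]]].
rewrite <- he by assumption.
apply cder_ext with (fun z => z * mean h z); [|now apply (mean_primitive h h')].
eapply near_imp; [|exact (D0_near z hz)].
intros y hy; symmetry; now apply (Li_word_cons a w h h').
Qed.

Lemma D1_1_minus z : D1 z <-> D0 (1 - z).
Proof.
unfold D1, D0; destruct z as [x y]; simpl.
split; intros h [h1 h2]; apply h; split; lra.
Qed.

Lemma D0_1_minus z : D0 z <-> D1 (1 - z).
Proof. rewrite D1_1_minus; replace (1 - (1 - z)) with z by ring; reflexivity. Qed.

Lemma D1_neq_0 z : D1 z -> z <> RtoC 0.
Proof. intros h ->; apply h; simpl; split; [reflexivity | lra]. Qed.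

Lemma Cmod_plus_Re_pos z : D1 z -> (0 < Cmod z + Re z)%R.
Proof.
intros h; destruct (Rlt_or_le 0 (Cmod z + Re z)) as [|hn]; [assumption|].
exfalso; apply h.
pose proof (Cmod_ge_0 z) as h0.
assert (h2 : (Cmod z * Cmod z = Re z * Re z + Im z * Im z)%R).
{ destruct z as [x y]; unfold Cmod; simpl; rewrite sqrt_sqrt; nra. }
split; nra.
Qed.

(** The two quotients are the real and imaginary parts of (b + i d) / (X + i Y), the logarithmic
    derivative along the line. The half-angle formula for the argument is one smooth expression on
    all of [D1], so no case distinction on quadrants arises. *)
Lemma is_derive_log_line (a b c d s : R) :
  D1 (a + s * b, c + s * d)%R ->
  let X := (a + s * b)%R in let Y := (c + s * d)%R in
  is_derive (fun s : R => Re (Clog (a + s * b, c + s * d)%R)) s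
    ((X * b + Y * d) / (X * X + Y * Y))%R /\
  is_derive (fun s : R => Im (Clog (a + s * b, c + s * d)%R)) s
    ((X * d - Y * b) / (X * X + Y * Y))%R.
Proof.
intros hD X Y; pose proof (Cmod_plus_Re_pos _ hD) as hp.
pose proof (proj1 (Cmod_gt_0 _) (D1_neq_0 _ hD)) as hr.
unfold Clog, Carg, Cmod in *; simpl in *; fold X Y in hp, hr.
rewrite !Rmult_1_r in hp, hr.
set (r := sqrt (X * X + Y * Y)) in *.
assert (hs : (0 < X * X + Y * Y)%R).
{ destruct (Rlt_or_le 0 (X * X + Y * Y)) as [|n]; [assumption|].
  unfold r in hr; rewrite sqrt_neg_0 in hr by exact n; lra. }
assert (hr2 : (r * r = X * X + Y * Y)%R) by (apply sqrt_sqrt; lra).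
split.
- auto_derive.
  + rewrite !Rmult_1_r; fold X Y; fold r; repeat split; assumption.
  + rewrite !Rmult_1_r; fold X Y; fold r; rewrite <- hr2; field; lra.
- auto_derive.
  + rewrite !Rmult_1_r; fold X Y; fold r; repeat split; lra.
  + rewrite !Rmult_1_r; fold X Y; fold r.
    (* The denominator 1 + t^2 in the derivative of atan at t = Y / (r + X), simplified by Y^2 = r^2
       - X^2. *)
    assert (e1 : (1 + Y * / (r + X) * (Y * / (r + X)) = 2 * r / (r + X))%R).
    { replace (1 + Y * / (r + X) * (Y * / (r + X)))%R
        with (((r + X) * (r + X) + Y * Y) / ((r + X) * (r + X)))%R by (field; lra).
      replace (Y * Y)%R with (r * r - X * X)%R by lra; field; lra. }
    rewrite e1, <- hr2.
    transitivity ((d * r * (r + X) - Y * (b * X + d * Y) - Y * b * r)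
                  / (r * r * (r + X)))%R; [field; lra|].
    replace (d * r * (r + X) - Y * (b * X + d * Y) - Y * b * r)%R
      with ((X * d - Y * b) * (r + X))%R; [field; lra|].
    replace (d * r * (r + X))%R with (d * (r * r) + d * r * X)%R by ring.
    rewrite hr2; ring.
Qed.

(** Put u = 1 - z. Along the segment from 1 to [z], the derivative of [Clog] (1 - s u) is -u / (1 -
    s u), the opposite of the integrand of Li(xi1; u), and [Clog] vanishes at 1. Real and imaginary
    parts are compared separately. *)
Lemma Clog_Li z : D1 z -> Clog z = - Li_word [xi1] (1 - z).
Proof.
intros hz; pose proof (proj1 (D1_1_minus z) hz) as hu.
set (u := 1 - z) in *.
assert (hL : Li_word [xi1] u = u * mean (fun t => / (1 - t)) u).
{ apply (Li_word_cons xi1 [] _ _ C1_inv_1_minus); [|exact hu].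
  intros t _ _; simpl; ring. }
assert (hi : is_CInt (fun s : R => u * / (1 - s * u)) (Li_word [xi1] u)).
{ assert (hc : forall y, D0 y -> ccont (fun t => / (1 - t)) y)
    by (intros y hy; exact (C1_cont _ _ _ C1_inv_1_minus hy)).
  rewrite hL.
  exact (is_CInt_scal u _ _ (proj1 (is_CInt_ray (fun t => / (1 - t)) u hc hu))). }
assert (hc : forall s : R, (0 <= s <= 1)%R ->
  continuous (U := C_R_NormedModule) (fun s : R => u * / (1 - s * u)) s).
{ intros s hs; apply (continuous_of_ccont (fun s => u * / (1 - s * u))).
  apply ccont_mult; [apply ccont_const|].
  apply (ccont_ray (fun t => / (1 - t))), (C1_cont _ _ _ C1_inv_1_minus).
  now apply D0_scal. }
destruct u as [p q] eqn:eu.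
assert (hz' : z = (1 - p, - q)%R).
{ replace z with (1 - u) by (unfold u; ring); rewrite eu.
  unfold Cminus, Cplus, Copp, RtoC; simpl; f_equal; ring. }
assert (hD : forall s : R, (0 <= s <= 1)%R -> D1 (1 + s * (- p), 0 + s * (- q))%R).
{ intros s hs; apply D1_1_minus.
  replace (1 - _) with (s * (p, q)); [now apply D0_scal|].
  unfold Cminus, Cplus, Cmult, Copp, RtoC; simpl; f_equal; ring. }
assert (h1 : forall s : R, (1 - s * (p, q)) = (1 + s * (- p), 0 + s * (- q))%R).
{ intros s; unfold Cminus, Cplus, Cmult, Copp, RtoC; simpl; f_equal; ring. }
assert (e0 : Clog (1, 0)%R = 0).
{ replace (1, 0)%R with (RtoC 1) by reflexivity.
  unfold Clog, Carg; rewrite Cmod_1; simpl.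
  replace (0 / (1 + 1))%R with 0%R by field.
  rewrite ln_1, atan_0, Rmult_0_r; reflexivity. }
assert (e1 : Clog (1 + 0 * (- p), 0 + 0 * (- q))%R = 0)
  by (rewrite <- e0; do 2 f_equal; ring).
assert (e2 : Clog (1 + 1 * (- p), 0 + 1 * (- q))%R = Clog z)
  by (rewrite hz'; do 2 f_equal; ring).
assert (hN : forall s : R, (0 <= s <= 1)%R ->
  let X := (1 + s * (- p))%R in let Y := (0 + s * (- q))%R in (X * X + Y * Y <> 0)%R).
{ intros s hs X Y e; apply (D1_neq_0 _ (hD s hs)); fold X Y.
  assert (X = 0%R) as -> by nra; assert (Y = 0%R) as -> by nra; reflexivity. }
pose proof (is_RInt_fct_extend_fst _ 0 1 _ hi) as hre.
pose proof (is_RInt_fct_extend_snd _ 0 1 _ hi) as him.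
assert (hre' : is_RInt (fun s : R => fst ((p, q) * / (1 - s * (p, q)))) 0 1
  (minus (- Re (Clog (1 + 1 * - p, 0 + 1 * - q)))
         (- Re (Clog (1 + 0 * - p, 0 + 0 * - q))))%R).
{ apply (is_RInt_derive (V := R_CompleteNormedModule)
    (fun s : R => (- Re (Clog (1 + s * - p, 0 + s * - q)))%R)).
  - intros s hs; rewrite Rmin_left, Rmax_right in hs by lra.
    pose proof (is_derive_opp _ _ _ (proj1 (is_derive_log_line _ _ _ _ s (hD s hs)))) as hd.
    match type of hd with is_derive _ _ ?l => replace (fst _) with l end; [exact hd|].
    rewrite h1; specialize (hN s hs); revert hN; cbv zeta.
    set (X := (1 + s * - p)%R); set (Y := (0 + s * - q)%R); intros hN.
    unfold opp; simpl; field; contradict hN; rewrite <- hN; ring.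
  - intros s hs; rewrite Rmin_left, Rmax_right in hs by lra.
    apply (continuous_comp (V := C_R_NormedModule)); [exact (hc s hs) | apply continuous_fst]. }
assert (him' : is_RInt (fun s : R => snd ((p, q) * / (1 - s * (p, q)))) 0 1
  (minus (- Im (Clog (1 + 1 * - p, 0 + 1 * - q)))
         (- Im (Clog (1 + 0 * - p, 0 + 0 * - q))))%R).
{ apply (is_RInt_derive (V := R_CompleteNormedModule)
    (fun s : R => (- Im (Clog (1 + s * - p, 0 + s * - q)))%R)).
  - intros s hs; rewrite Rmin_left, Rmax_right in hs by lra.
    pose proof (is_derive_opp _ _ _ (proj2 (is_derive_log_line _ _ _ _ s (hD s hs)))) as hd.
    match type of hd with is_derive _ _ ?l => replace (snd _) with l end; [exact hd|].
    rewrite h1; specialize (hN s hs); revert hN; cbv zeta.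
    set (X := (1 + s * - p)%R); set (Y := (0 + s * - q)%R); intros hN.
    unfold opp; simpl; field; contradict hN; rewrite <- hN; ring.
  - intros s hs; rewrite Rmin_left, Rmax_right in hs by lra.
    apply (continuous_comp (V := C_R_NormedModule)); [exact (hc s hs) | apply continuous_snd]. }
rewrite e1, e2 in hre', him'.
pose proof (eq_trans
  (eq_sym (is_RInt_unique (V := R_CompleteNormedModule) _ _ _ _ hre))
  (is_RInt_unique (V := R_CompleteNormedModule) _ _ _ _ hre')) as a1.
pose proof (eq_trans
  (eq_sym (is_RInt_unique (V := R_CompleteNormedModule) _ _ _ _ him))
  (is_RInt_unique (V := R_CompleteNormedModule) _ _ _ _ him')) as a2.
clear hre hre' him him' hL hi.
set (L := Li_word [xi1] (p, q)) in *; clearbody L.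
destruct (Clog z) as [x y], L as [x' y']; simpl in a1, a2.
unfold minus, plus, opp in a1, a2; simpl in a1, a2.
unfold Copp; simpl; f_equal; lra.
Qed.

(** Derivatives along lines alone do not give a complex derivative; it is inherited from the
    primitive Li(xi1; 1 - z) instead. *)
Lemma Clog_cder z : D1 z -> cder Clog z (/ z).
Proof.
intros hz; pose proof (proj1 (D1_1_minus z) hz) as hu.
pose proof (D1_neq_0 z hz) as hz0.
apply cder_ext with (fun z => - Li_word [xi1] (1 - z)).
- destruct (D0_near _ hu) as [d [hd h]]; exists d; split; [exact hd|].
  intros y hy; symmetry; apply Clog_Li, D1_1_minus, h.
  replace (1 - y - (1 - z)) with (- (y - z)) by ring; now rewrite Cmod_opp.
- assert (hg : cder (fun t => t * mean (fun t => / (1 - t)) t) (1 - z) (/ (1 - (1 - z)))).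
  { exact (mean_primitive _ _ _ C1_inv_1_minus hu). }
  assert (hL : cder (Li_word [xi1]) (1 - z) (/ z)).
  { replace (/ z) with (/ (1 - (1 - z))) by (f_equal; ring).
    apply cder_ext with (2 := hg).
    eapply near_imp; [|exact (D0_near _ hu)]; intros y hy; symmetry.
    apply (Li_word_cons xi1 [] _ _ C1_inv_1_minus); [|exact hy].
    intros t _ _; simpl; ring. }
  pose proof (cder_scal (- (1)) _ _ _
    (cder_comp (Li_word [xi1]) (fun z => 1 - z) _ _ _ (cder_1_minus z) hL)) as h.
  eapply cder_ext; [|eapply cder_eq; [exact h|ring]].
  exists 1%R; split; [lra | intros; cbv beta; ring].
Qed.

(** [D0] and [D1] are both star-shaped about 1/2, so every point is joined to 1/2 by a segment on
    which [F] has derivative 0. *)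
Lemma cder_0_const F :
  (forall z, D0 z -> D1 z -> cder F z 0) ->
  forall z y, D0 z -> D1 z -> D0 y -> D1 y -> F z = F y.
Proof.
intros h.
set (c := RtoC (1 / 2)).
assert (hc : forall z, D0 z -> D1 z -> F c = F z).
{ intros z h0 h1.
  replace (F c) with (F (c + 0%R * (z - c))) by (f_equal; ring).
  replace (F z) with (F (c + 1%R * (z - c))) by (f_equal; ring).
  apply (eq_is_derive (V := C_R_NormedModule) (fun s : R => F (c + s * (z - c)))); [|lra].
  intros s hs.
  assert (hx : Re (c + s * (z - c)) = (1 / 2 + s * (Re z - 1 / 2))%R)
    by (destruct z; unfold c; simpl; ring).
  assert (hy : Im (c + s * (z - c)) = (s * Im z)%R)
    by (destruct z; unfold c; simpl; ring).
  replace (zero (G := C_R_NormedModule)) with (0 * (z - c)) by (rewrite Cmult_0_l; reflexivity).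
  apply is_derive_line, h.
  - intros [g1 g2]; rewrite hx in g2; rewrite hy in g1.
    assert (s <> 0%R) by (intros ->; lra).
    apply h0; split; [|nra].
    apply Rmult_eq_reg_l with s; [lra | assumption].
  - intros [g1 g2]; rewrite hx in g2; rewrite hy in g1.
    assert (s <> 0%R) by (intros ->; lra).
    apply h1; split; [|nra].
    apply Rmult_eq_reg_l with s; [lra | assumption]. }
intros z y z0 z1 y0 y1; rewrite <- (hc z z0 z1); now apply hc.
Qed.

(** * Linear functionals and shuffles *)

Lemma lin_app f p q : lin f (p ++ q) = lin f p + lin f q.
Proof. induction p as [|[c u] p IH]; simpl; [ring | rewrite IH; ring]. Qed.

Lemma lin_scale f c p : lin f (scale c p) = c * lin f p.
Proof. induction p as [|[d u] p IH]; simpl; [ring | rewrite IH; ring]. Qed.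

Lemma lin_linp f g p : lin f (linp g p) = lin (fun u => lin f (g u)) p.
Proof.
induction p as [|[c u] p IH]; simpl; [reflexivity|].
now rewrite lin_app, lin_scale, <- IH.
Qed.

Lemma lin_mono f w : lin f (mono w) = f w.
Proof. simpl; ring. Qed.

Lemma lin_ext f g p : (forall w, f w = g w) -> lin f p = lin g p.
Proof.
intros h; induction p as [|[c u] p IH]; simpl; [reflexivity | now rewrite IH, h].
Qed.

Lemma lin_plus f g p : lin (fun w => f w + g w) p = lin f p + lin g p.
Proof. induction p as [|[c u] p IH]; simpl; [ring | rewrite IH; ring]. Qed.

Lemma lin_mul c f p : lin (fun w => c * f w) p = c * lin f p.
Proof. induction p as [|[d u] p IH]; simpl; [ring | rewrite IH; ring]. Qed.

Lemma lin_conc f p q :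
  lin f (conc p q) = lin (fun u => lin (fun v => f (u ++ v)) q) p.
Proof.
unfold conc; rewrite lin_linp; apply lin_ext; intros u.
rewrite lin_linp; apply lin_ext; intros v; apply lin_mono.
Qed.

Definition remove_word (u : word) (p : ncpoly) : ncpoly :=
  filter (fun t => if word_eq_dec (snd t) u then false else true) p.

Lemma lin_remove_word f u p : lin f p = coeff u p * f u + lin f (remove_word u p).
Proof.
induction p as [|[c v] p IH]; [simpl; ring|].
unfold coeff, remove_word in *; simpl.
destruct (word_eq_dec v u) as [->|n]; simpl; rewrite IH; ring.
Qed.

(** A word may occur several times in the list. Removing all occurrences of the first word at once
    subtracts its coefficient, which is 0, and strictly shortens the list. *)
Lemma lin_coeff_0 f p : (forall w, coeff w p = 0) -> lin f p = 0.
Proof.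
remember (length p) as n eqn:hn; revert p hn.
induction n as [n IH] using (well_founded_induction Wf_nat.lt_wf).
intros [|[c u] p] hn h; [reflexivity|].
rewrite (lin_remove_word f u), h.
rewrite (IH (length (remove_word u ((c, u) :: p)))); [ring | | reflexivity |].
- subst n; unfold remove_word; simpl.
  destruct (word_eq_dec u u) as [_|ne]; [|now destruct ne].
  pose proof (filter_length_le (fun t : C * word =>
    if word_eq_dec (snd t) u then false else true) p); lia.
- intros w; destruct (word_eq_dec u w) as [<-|ne].
  + set (q := (c, u) :: p); clearbody q; clear.
    induction q as [|[d v] q IH]; [reflexivity|].
    unfold remove_word in *; simpl; destruct (word_eq_dec v u) as [e|ne]; simpl; [exact IH|].
    unfold coeff; simpl; destruct (word_eq_dec v u) as [e|_]; [easy|].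
    unfold coeff in IH; rewrite IH; ring.
  + specialize (h w); unfold coeff in h; rewrite (lin_remove_word _ u) in h.
    destruct (word_eq_dec u w) as [e|_]; [easy|].
    rewrite Cmult_0_r, Cplus_0_l in h; exact h.
Qed.

(** With its converse [lin_nceq], this replaces equality in S by equality under every linear
    functional, the form in which all later identities are proved. *)
Lemma nceq_lin p q : nceq p q -> forall f, lin f p = lin f q.
Proof.
intros h f.
assert (e : lin f (p ++ scale (- (1)) q) = 0).
{ apply lin_coeff_0; intros w; unfold coeff; rewrite lin_app, lin_scale.
  specialize (h w); unfold coeff in h; rewrite h; ring. }
rewrite lin_app, lin_scale in e.
replace (lin f p) with (lin f p + - (1) * lin f q + lin f q) by ring.
rewrite e; ring.
Qed.

Lemma lin_nceq p q : (forall f, lin f p = lin f q) -> nceq p q.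
Proof. intros h w; apply h. Qed.

(** The shuffle product seen from the dual side: with [f] arbitrary, its recursion becomes an
    equation in C that [ring] can use. *)
Definition sh (f : word -> C) (u v : word) : C := lin f (shuffle_word u v).

Lemma lin_shuffle f p q :
  lin f (shuffle p q) = lin (fun u => lin (fun v => sh f u v) q) p.
Proof.
unfold shuffle; rewrite lin_linp; apply lin_ext; intros u; apply lin_linp.
Qed.

Lemma sh_nil_l f v : sh f [] v = f v.
Proof. apply lin_mono. Qed.

Lemma sh_nil_r f u : sh f u [] = f u.
Proof. destruct u; apply lin_mono. Qed.

Lemma sh_cons f a u b v :
  sh f (a :: u) (b :: v) =
  sh (fun w => f (a :: w)) u (b :: v) + sh (fun w => f (b :: w)) (a :: u) v.
Proof.
unfold sh at 1.
change (shuffle_word (a :: u) (b :: v)) with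
  (conc (mono [a]) (shuffle_word u (b :: v)) ++ conc (mono [b]) (shuffle_word (a :: u) v)).
rewrite lin_app, !lin_conc, !lin_mono; reflexivity.
Qed.

Lemma sh_ext f g u v : (forall w, f w = g w) -> sh f u v = sh g u v.
Proof. apply lin_ext. Qed.

Lemma sh_plus f g u v : sh (fun w => f w + g w) u v = sh f u v + sh g u v.
Proof. apply lin_plus. Qed.

Lemma sh_mul c f u v : sh (fun w => c * f w) u v = c * sh f u v.
Proof. apply lin_mul. Qed.

(** The shuffle recursion may equally be run on last letters: expand both sides by first letters and
    regroup by induction. This gives compatibility with reversal and drives the splitting off of
    trailing [xi0]. *)
Lemma sh_snoc f u a v b :
  sh f (u ++ [a]) (v ++ [b]) =
  sh (fun w => f (w ++ [a])) u (v ++ [b]) + sh (fun w => f (w ++ [b])) (u ++ [a]) v.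
Proof.
revert f v; induction u as [|c u IHu]; intros f v.
- revert f; induction v as [|d v IHv]; intros f; simpl.
  + rewrite sh_cons, !sh_nil_l, !sh_nil_r; simpl; ring.
  + rewrite sh_cons, IHv; simpl.
    rewrite sh_cons, !sh_nil_l; simpl; ring.
- revert f; induction v as [|d v IHv]; intros f; simpl.
  + specialize (IHu (fun w => f (c :: w)) []); simpl in IHu.
    rewrite sh_cons, IHu.
    rewrite sh_cons, !sh_nil_r; simpl; ring.
  + specialize (IHu (fun w => f (c :: w)) (d :: v)); simpl in IHu, IHv.
    rewrite sh_cons, IHu, IHv.
    rewrite (sh_cons (fun w => f (w ++ [a]))), (sh_cons (fun w => f (w ++ [b]))).
    simpl; ring.
Qed.

Lemma sh_rev f u v : sh f (rev u) (rev v) = sh (fun w => f (rev w)) u v.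
Proof.
revert f v; induction u as [|a u IHu]; intros f v; [now rewrite !sh_nil_l|].
revert f; induction v as [|b v IHv]; intros f; [now rewrite !sh_nil_r|].
simpl rev at 1 2; rewrite sh_snoc, sh_cons.
specialize (IHu (fun w => f (w ++ [a])) (b :: v)).
specialize (IHv (fun w => f (w ++ [b]))); simpl in IHu, IHv.
now rewrite IHu, IHv.
Qed.

Lemma sh_map f g u v : sh f (map g u) (map g v) = sh (fun w => f (map g w)) u v.
Proof.
revert f v; induction u as [|a u IHu]; intros f v; [now rewrite !sh_nil_l|].
revert f; induction v as [|b v IHv]; intros f; [now rewrite !sh_nil_r|].
simpl; rewrite !sh_cons.
specialize (IHu (fun w => f (g a :: w)) (b :: v)).
specialize (IHv (fun w => f (g b :: w))); simpl in IHu, IHv.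
now rewrite IHu, IHv.
Qed.

Definition natC (n : nat) : C := RtoC (INR n).

Lemma natC_S n : natC (S n) = natC n + 1.
Proof. unfold natC; now rewrite S_INR, RtoC_plus. Qed.

Lemma natC_fact_S n : natC (fact (S n)) = (natC n + 1) * natC (fact n).
Proof.
rewrite <- natC_S; unfold natC.
now rewrite <- RtoC_mult, <- mult_INR.
Qed.

Lemma natC_fact_neq_0 n : natC (fact n) <> 0.
Proof. intros e; apply RtoC_inj in e; now apply INR_fact_neq_0 in e. Qed.

(** a^m sh a^n is the binomial multiple of a^(m+n), cleared of denominators; the induction is
    Pascal's rule. *)
Lemma sh_repeat f a m n :
  natC (fact m) * natC (fact n) * sh f (repeat a m) (repeat a n)
  = natC (fact (m + n)) * f (repeat a (m + n)).
Proof.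
revert f n; induction m as [|m IHm]; intros f n.
{ simpl; rewrite sh_nil_l; unfold natC at 1; simpl; ring. }
revert f; induction n as [|n IHn]; intros f.
{ rewrite Nat.add_0_r; simpl repeat at 2; rewrite sh_nil_r.
  unfold natC at 2; simpl INR; ring. }
simpl repeat at 1 2; rewrite sh_cons.
specialize (IHm (fun w => f (a :: w)) (S n)).
specialize (IHn (fun w => f (a :: w))); simpl repeat in IHm, IHn.
replace (S m + S n)%nat with (S (S m + n)) by lia.
replace (m + S n)%nat with (S m + n)%nat in IHm by lia.
rewrite Cmult_plus_distr_l.
rewrite (natC_fact_S m), (natC_fact_S n), (natC_fact_S (S m + n)).
rewrite (natC_fact_S n) in IHm; rewrite (natC_fact_S m) in IHn.
transitivity ((natC m + 1) * (natC (fact (S m + n)) * f (a :: repeat a (S m + n)))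
  + (natC n + 1) * (natC (fact (S m + n)) * f (a :: repeat a (S m + n)))).
- simpl repeat; rewrite <- IHm at 1; rewrite <- IHn; ring.
- replace (natC (S m + n)) with (natC m + 1 + natC n)
    by (rewrite <- natC_S; unfold natC; now rewrite plus_INR, RtoC_plus).
  simpl; ring.
Qed.

(* [dsum F w] is the sum of [F u v] over the factorizations [w = u ++ v]. *)
Fixpoint dsum (F : word -> word -> C) (w : word) : C :=
  F [] w + match w with
           | [] => 0
           | a :: w' => dsum (fun u v => F (a :: u) v) w'
           end.

Lemma dsum_ext F G w : (forall u v, F u v = G u v) -> dsum F w = dsum G w.
Proof.
revert F G; induction w as [|a w IH]; intros F G h; simpl; rewrite h; [reflexivity|].
f_equal; apply IH; auto.
Qed.

Lemma dsum_plus F G w : dsum (fun u v => F u v + G u v) w = dsum F w + dsum G w.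
Proof.
revert F G; induction w as [|a w IH]; intros F G; simpl; [ring | rewrite IH; ring].
Qed.

Lemma dsum_mul c F w : dsum (fun u v => c * F u v) w = c * dsum F w.
Proof. revert F; induction w as [|a w IH]; intros F; simpl; [ring | rewrite IH; ring]. Qed.

(** Deconcatenation is a morphism for the shuffle product, the bialgebra axiom in dual form: each
    factorization of a shuffle of [u] and [v] comes from factorizations of [u] and of [v]. *)
Lemma sh_dsum (f g : word -> C) u v :
  sh (dsum (fun x y => f x * g y)) u v =
  dsum (fun u1 u2 => dsum (fun v1 v2 => sh f u1 v1 * sh g u2 v2) v) u.
Proof.
revert f v; induction u as [|a u IHu]; intros f v.
{ rewrite sh_nil_l; simpl.
  rewrite Cplus_0_r; apply dsum_ext; intros; now rewrite !sh_nil_l. }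
revert f; induction v as [|b v IHv]; intros f.
{ rewrite sh_nil_r; apply dsum_ext; intros x y; simpl.
  now rewrite !sh_nil_r, Cplus_0_r. }
rewrite sh_cons; simpl dsum at 1 2.
rewrite !sh_plus, !sh_mul.
rewrite (IHu (fun w => f (a :: w))), (IHv (fun w => f (b :: w))).
simpl dsum; rewrite (sh_cons g), !sh_nil_l.
assert (e1 : dsum (fun v1 v2 => sh f [] (b :: v1) * sh g (a :: u) v2) v =
  dsum (fun v1 v2 => sh (fun w => f (b :: w)) [] v1 * sh g (a :: u) v2) v)
  by (apply dsum_ext; intros; now rewrite !sh_nil_l).
assert (e2 : dsum (fun u1 u2 => sh f (a :: u1) [] * sh g u2 (b :: v) +
    dsum (fun v1 v2 => sh f (a :: u1) (b :: v1) * sh g u2 v2) v) u =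
  dsum (fun u1 u2 => (sh (fun w => f (a :: w)) u1 [] * sh g u2 (b :: v) +
     dsum (fun v1 v2 => sh (fun w => f (a :: w)) u1 (b :: v1) * sh g u2 v2) v) +
     dsum (fun v1 v2 => sh (fun w => f (b :: w)) (a :: u1) v1 * sh g u2 v2) v) u).
{ apply dsum_ext; intros u1 u2.
  rewrite !sh_nil_r, <- Cplus_assoc, <- dsum_plus; f_equal.
  apply dsum_ext; intros v1 v2; rewrite sh_cons; ring. }
rewrite e1, e2, !dsum_plus; ring.
Qed.

Definition sh_char (f : word -> C) : Prop :=
  f [] = 1 /\ forall u v, sh f u v = f u * f v.

Lemma dsum_char f g :
  sh_char f -> sh_char g -> sh_char (dsum (fun u v => f u * g v)).
Proof.
intros [f0 hf] [g0 hg]; split; [simpl; rewrite f0, g0; ring|].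
intros u v; rewrite sh_dsum.
transitivity (dsum (fun u1 u2 => f u1 * g u2 * dsum (fun v1 v2 => f v1 * g v2) v) u).
- apply dsum_ext; intros u1 u2; rewrite <- dsum_mul.
  apply dsum_ext; intros v1 v2; rewrite hf, hg; ring.
- rewrite (Cmult_comm (dsum _ u)), <- dsum_mul.
  apply dsum_ext; intros; ring.
Qed.

Lemma sh_char_lin f p q :
  sh_char f -> lin f (shuffle p q) = lin f p * lin f q.
Proof.
intros [_ h]; rewrite lin_shuffle, (Cmult_comm (lin f p)), <- lin_mul.
apply lin_ext; intros u; rewrite Cmult_comm, <- lin_mul.
apply lin_ext; intros v; apply h.
Qed.

Definition tau_word (w : word) : word := rev (map swap w).

Lemma lin_tau f p : lin f (tau p) = lin (fun w => f (tau_word w)) p.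
Proof. unfold tau; rewrite lin_linp; apply lin_ext; intros w; apply lin_mono. Qed.

Lemma sh_char_tau f : sh_char f -> sh_char (fun w => f (tau_word w)).
Proof.
intros [h0 h]; split; [exact h0|]; intros u v; unfold tau_word.
rewrite <- (h (rev (map swap u))), sh_rev.
now rewrite (sh_map (fun w => f (rev w))).
Qed.

Lemma sh_char_repeat f a n :
  sh_char f -> natC (fact n) * f (repeat a n) = f [a] ^ n.
Proof.
intros [h0 h]; induction n as [|n IH]; [simpl; rewrite h0; unfold natC; simpl; ring|].
pose proof (sh_repeat f a 1 n) as e; rewrite h in e; simpl Nat.add in e.
rewrite <- e; simpl Cpow; rewrite <- IH; simpl repeat; unfold natC at 1; simpl; ring.
Qed.

Lemma sh_char_repeat_0 f a n :
  sh_char f -> f [a] = 0 -> f (repeat a (S n)) = 0.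
Proof.
intros h e; pose proof (sh_char_repeat f a (S n) h) as hr.
rewrite e in hr; simpl Cpow in hr; rewrite Cmult_0_l in hr.
destruct (excluded_middle_informative (f (repeat a (S n)) = 0)) as [h0|h0]; [exact h0|].
now destruct (Cmult_neq_0 _ _ (natC_fact_neq_0 (S n)) h0).
Qed.

(** * Decompositions along the shuffle product *)

Lemma Csum_ext n f g : (forall j, (j < n)%nat -> f j = g j) -> Csum n f = Csum n g.
Proof.
intros h; unfold Csum.
assert (h' : forall j, In j (seq 0 n) -> f j = g j)
  by (intros j hj; apply h; apply in_seq in hj; lia).
induction (seq 0 n) as [|a l IH]; simpl; [reflexivity|].
rewrite (h' a), IH; [reflexivity | | now left]; intros j hj; apply h'; now right.
Qed.

Lemma Csum_plus n f g : Csum n (fun j => f j + g j) = Csum n f + Csum n g.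
Proof. unfold Csum; induction (seq 0 n) as [|a l IH]; simpl; [ring | rewrite IH; ring]. Qed.

Lemma Csum_shift n f : Csum (S n) f = f 0%nat + Csum n (fun j => f (S j)).
Proof.
unfold Csum; simpl; rewrite <- seq_shift; f_equal.
induction (seq 0 n) as [|a l IH]; simpl; [reflexivity | now rewrite IH].
Qed.

Lemma Csum_0 n : Csum n (fun _ => 0) = 0.
Proof. unfold Csum; induction (seq 0 n) as [|a l IH]; simpl; [ring | rewrite IH; ring]. Qed.

Lemma Csum_single n i (f : nat -> C) :
  (i < n)%nat -> (forall j, j <> i -> f j = 0) -> Csum n f = f i.
Proof.
revert i f; induction n as [|n IH]; intros i f hi h; [lia|].
rewrite Csum_shift; destruct i as [|i].
- rewrite (Csum_ext _ _ (fun _ => 0)), Csum_0; [ring|].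
  intros j _; apply h; lia.
- rewrite (h 0%nat), (IH i); [ring | lia | | lia]; intros j hj; apply h; lia.
Qed.

Lemma lin_ncsum f n g : lin f (ncsum n g) = Csum n (fun j => lin f (g j)).
Proof.
unfold ncsum, Csum; induction (seq 0 n) as [|a l IH]; simpl; [reflexivity|].
now rewrite lin_app, IH.
Qed.

Lemma lin_conc_r f p a : lin f (conc p (mono [a])) = lin (fun u => f (u ++ [a])) p.
Proof. rewrite lin_conc; apply lin_ext; intros u.
exact (lin_mono (fun v => f (u ++ v)) [a]).
Qed.

Lemma lin_conc_l f a p : lin f (conc (mono [a]) p) = lin (fun u => f (a :: u)) p.
Proof. now rewrite lin_conc, lin_mono. Qed.

Lemma in_S0_lin p : in_S0 p <-> exists c q, forall f,
  lin f p = c * f [] + lin (fun u => f (u ++ [xi1])) q.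
Proof.
assert (e : forall f c q, lin f (scale c (mono []) ++ conc q (mono [xi1])) =
  c * f [] + lin (fun u => f (u ++ [xi1])) q).
{ intros f c q; now rewrite lin_app, lin_scale, lin_mono, lin_conc_r. }
split; intros [c [q h]]; exists c, q.
- intros f; rewrite <- e; now apply nceq_lin.
- apply lin_nceq; intros f; now rewrite e.
Qed.

Lemma in_S10_lin p : in_S10 p <-> exists c q, forall f,
  lin f p = c * f [] + lin (fun u => f (xi0 :: u ++ [xi1])) q.
Proof.
assert (e : forall f c q,
  lin f (scale c (mono []) ++ conc (mono [xi0]) (conc q (mono [xi1]))) =
  c * f [] + lin (fun u => f (xi0 :: u ++ [xi1])) q).
{ intros f c q; now rewrite lin_app, lin_scale, lin_mono, lin_conc_l, lin_conc_r. }
split; intros [c [q h]]; exists c, q.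
- intros f; rewrite <- e; now apply nceq_lin.
- apply lin_nceq; intros f; now rewrite e.
Qed.

Lemma in_S10_S0 p : in_S10 p -> in_S0 p.
Proof.
intros h; apply in_S10_lin in h; destruct h as [c [q h]]; apply in_S0_lin.
exists c, (conc (mono [xi0]) q); intros f.
now rewrite h, lin_conc_l.
Qed.

Lemma in_S0_scale c p : in_S0 p -> in_S0 (scale c p).
Proof.
intros h; apply in_S0_lin in h; destruct h as [d [q h]]; apply in_S0_lin.
exists (c * d), (scale c q); intros f; rewrite !lin_scale, h; ring.
Qed.

Lemma in_S10_scale c p : in_S10 p -> in_S10 (scale c p).
Proof.
intros h; apply in_S10_lin in h; destruct h as [d [q h]]; apply in_S10_lin.
exists (c * d), (scale c q); intros f; rewrite !lin_scale, h; ring.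
Qed.

Lemma in_S0_app p p' : in_S0 p -> in_S0 p' -> in_S0 (p ++ p').
Proof.
rewrite !in_S0_lin; intros [c [q h]] [c' [q' h']].
exists (c + c'), (q ++ q'); intros f; rewrite !lin_app, h, h'; ring.
Qed.

Lemma in_S10_app p p' : in_S10 p -> in_S10 p' -> in_S10 (p ++ p').
Proof.
rewrite !in_S10_lin; intros [c [q h]] [c' [q' h']].
exists (c + c'), (q ++ q'); intros f; rewrite !lin_app, h, h'; ring.
Qed.

Lemma in_S10_nil : in_S10 [].
Proof. apply in_S10_lin; exists 0, []; intros f; simpl; ring. Qed.

Lemma in_S10_one : in_S10 (mono []).
Proof. apply in_S10_lin; exists 1, []; intros f; simpl; ring. Qed.

Lemma in_S0_snoc q : in_S0 (conc q (mono [xi1])).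
Proof.
apply in_S0_lin; exists 0, q; intros f.
now rewrite lin_conc_r, Cmult_0_l, Cplus_0_l.
Qed.

Lemma in_S10_cons_snoc q : in_S10 (conc (mono [xi0]) (conc q (mono [xi1]))).
Proof.
apply in_S10_lin; exists 0, q; intros f.
now rewrite lin_conc_l, lin_conc_r, Cmult_0_l, Cplus_0_l.
Qed.

(** A decomposition with unsorted and possibly repeated indices. In this form sums and multiples are
    immediate; sorting by index is postponed to [collect]. *)
Definition spanned {I : Type} (T : I -> ncpoly -> ncpoly) (P : ncpoly -> Prop)
  (p : ncpoly) : Prop :=
  exists l : list (I * ncpoly)%type, List.Forall (fun t => P (snd t)) l /\
    forall f, lin f p = lin f (flat_map (fun t => T (fst t) (snd t)) l).

Lemma spanned_gen {I} (T : I -> ncpoly -> ncpoly) P i x : P x -> spanned T P (T i x).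
Proof.
intros h; exists [(i, x)]; split; [now constructor|].
intros f; simpl; now rewrite app_nil_r.
Qed.

Lemma spanned_eq {I} (T : I -> ncpoly -> ncpoly) P p q : (forall f, lin f p = lin f q) -> spanned T P p -> spanned T P q.
Proof. intros h [l [hl hp]]; exists l; split; [exact hl|]; intros f; now rewrite <- h. Qed.

Lemma spanned_nil {I} (T : I -> ncpoly -> ncpoly) P : spanned T P [].
Proof. exists []; split; [constructor | reflexivity]. Qed.

Lemma spanned_app {I} (T : I -> ncpoly -> ncpoly) P p q : spanned T P p -> spanned T P q -> spanned T P (p ++ q).
Proof.
intros [l [hl hp]] [m [hm hq]]; exists (l ++ m); split; [now apply List.Forall_app|].
intros f; now rewrite flat_map_app, !lin_app, hp, hq.
Qed.

Lemma spanned_scale {I} (T : I -> ncpoly -> ncpoly) P c p :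
  (forall c p, P p -> P (scale c p)) ->
  (forall i c p f, lin f (T i (scale c p)) = c * lin f (T i p)) ->
  spanned T P p -> spanned T P (scale c p).
Proof.
intros hP hT [l [hl hp]]; exists (map (fun t => (fst t, scale c (snd t))) l); split.
- apply List.Forall_map; eapply List.Forall_impl; [|exact hl]; intros t; apply hP.
- intros f; rewrite lin_scale, hp; clear hp hl.
  induction l as [|t l IH]; simpl; [ring|].
  rewrite !lin_app, <- IH, hT; ring.
Qed.

Lemma spanned_linp {I} (T : I -> ncpoly -> ncpoly) P g p :
  (forall c p, P p -> P (scale c p)) ->
  (forall i c p f, lin f (T i (scale c p)) = c * lin f (T i p)) ->
  (forall w, spanned T P (g w)) -> spanned T P (linp g p).
Proof.
intros hP hT h; induction p as [|[c u] p IH]; simpl; [apply spanned_nil|].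
apply spanned_app; [now apply spanned_scale | exact IH].
Qed.

Lemma spanned_flat_map {I} (T : I -> ncpoly -> ncpoly) P {J} (U : J -> ncpoly) (l : list J) :
  (forall j, In j l -> spanned T P (U j)) -> spanned T P (flat_map U l).
Proof.
intros h; induction l as [|j l IH]; simpl; [apply spanned_nil|].
apply spanned_app; [apply h; now left | apply IH; intros; apply h; now right].
Qed.

Definition T0 (j : nat) (x : ncpoly) : ncpoly := shuffle x (letter_pow xi0 j).
Definition T1 (i : nat) (x : ncpoly) : ncpoly := shuffle (letter_pow xi1 i) x.
Definition T10 (t : (nat * nat)%type) (x : ncpoly) : ncpoly := T0 (snd t) (T1 (fst t) x).

Lemma lin_T0 f j x : lin f (T0 j x) = lin (fun u => sh f u (repeat xi0 j)) x.
Proof.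
unfold T0; rewrite lin_shuffle; apply lin_ext; intros u.
exact (lin_mono (sh f u) (repeat xi0 j)).
Qed.

Lemma lin_T1 f i x : lin f (T1 i x) = lin (fun u => sh f (repeat xi1 i) u) x.
Proof.
unfold T1; rewrite lin_shuffle.
exact (lin_mono (fun v => lin (sh f v) x) (repeat xi1 i)).
Qed.

Lemma lin_T10 f t x : lin f (T10 t x) =
  lin (fun u => sh f u (repeat xi0 (snd t))) (T1 (fst t) x).
Proof. apply lin_T0. Qed.

Lemma lin_T0_0 f x : lin f (T0 0 x) = lin f x.
Proof. rewrite lin_T0; apply lin_ext; intros u; apply sh_nil_r. Qed.

Lemma lin_T1_0 f x : lin f (T1 0 x) = lin f x.
Proof. rewrite lin_T1; apply lin_ext; intros u; apply sh_nil_l. Qed.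

Lemma T1_scale j c p f : lin f (T1 j (scale c p)) = c * lin f (T1 j p).
Proof. now rewrite !lin_T1, lin_scale. Qed.

Lemma T10_scale j c p f : lin f (T10 j (scale c p)) = c * lin f (T10 j p).
Proof. now rewrite !lin_T10, T1_scale. Qed.

(** Induction on the last letter. A word ending in [xi1] already lies in S^0; appending [xi0] to x
    sh xi0^j gives x sh xi0^(j+1) up to an element of S^0. *)
Lemma spanned_T0 w : spanned T0 in_S0 (mono w).
Proof.
induction w as [|a w IH] using rev_ind.
- apply spanned_eq with (T0 0 (mono [])); [intros f; rewrite lin_T0; apply lin_mono|].
  apply spanned_gen, in_S10_S0, in_S10_one.
- destruct a.
  2:{ apply spanned_eq with (T0 0 (conc (mono w) (mono [xi1]))).
      - intros f; now rewrite lin_T0_0, lin_conc_r, !lin_mono.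
      - apply spanned_gen, in_S0_snoc. }
  destruct IH as [l [hl hp]].
  apply spanned_eq with
    (flat_map (fun t => conc (T0 (fst t) (snd t)) (mono [xi0])) l).
  { intros f; rewrite lin_mono; specialize (hp (fun u => f (u ++ [xi0]))).
    rewrite lin_mono in hp; rewrite hp; clear.
    induction l as [|t l IH]; simpl; [reflexivity|].
    now rewrite !lin_app, IH, lin_conc_r. }
  apply spanned_flat_map; intros [j x] hx; cbn [fst snd].
  rewrite Forall_forall in hl; specialize (hl _ hx); simpl in hl.
  pose proof hl as hS; apply in_S0_lin in hl; destruct hl as [c [q hq]].
  (* [(u xi1) sh xi0^(j+1) = ((u xi1) sh xi0^j) xi0 + (u sh xi0^(j+1)) xi1] *)
  apply spanned_eq with (T0 (S j) x ++
    T0 0 (scale (- (1)) (conc (T0 (S j) q) (mono [xi1])))).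
  + intros f; rewrite lin_app, lin_T0_0, lin_scale, !lin_conc_r, !lin_T0, !hq.
    rewrite !sh_nil_l.
    rewrite (lin_ext (fun u => sh f (u ++ [xi1]) _)
      (fun u => sh (fun u => f (u ++ [xi1])) u (repeat xi0 (S j)) +
                sh (fun u => f (u ++ [xi0])) (u ++ [xi1]) (repeat xi0 j))).
    * rewrite lin_plus; simpl repeat at 1; rewrite repeat_cons; ring.
    * intros u; simpl repeat; rewrite repeat_cons; apply sh_snoc.
  + apply spanned_app; apply spanned_gen; [exact hS | apply in_S0_scale, in_S0_snoc].
Qed.

(** The mirror image, by induction on the first letter. The final [xi1] is carried along so that the
    corrections land in xi0 S xi1 and not merely in xi0 S. *)
Lemma spanned_T1 u : spanned T1 in_S10 (mono (u ++ [xi1])).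
Proof.
induction u as [|a u IH].
- apply spanned_eq with (T1 1 (mono [])).
  + intros f; rewrite lin_T1, !lin_mono; exact (sh_nil_r f [xi1]).
  + apply spanned_gen, in_S10_one.
- destruct a.
  { apply spanned_eq with (T1 0 (conc (mono [xi0]) (conc (mono u) (mono [xi1])))).
    - intros f; rewrite lin_T1, lin_conc_l, lin_conc_r, !lin_mono; apply sh_nil_l.
    - apply spanned_gen, in_S10_cons_snoc. }
  destruct IH as [l [hl hp]].
  apply spanned_eq with
    (flat_map (fun t => conc (mono [xi1]) (T1 (fst t) (snd t))) l).
  { intros f; rewrite lin_mono; specialize (hp (fun u => f (xi1 :: u))).
    rewrite lin_mono in hp.
    change ((xi1 :: u) ++ [xi1]) with (xi1 :: u ++ [xi1]); rewrite hp; clear.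
    induction l as [|t l IH]; cbn [flat_map]; [reflexivity|].
    now rewrite !lin_app, IH, lin_conc_l. }
  apply spanned_flat_map; intros [i x] hx; cbn [fst snd].
  rewrite Forall_forall in hl; specialize (hl _ hx); simpl in hl.
  pose proof hl as hS; apply in_S10_lin in hl; destruct hl as [c [q hq]].
  (* [xi1^(i+1) sh (xi0 u xi1)
      = xi1 (xi1^i sh (xi0 u xi1)) + xi0 (xi1^(i+1) sh (u xi1))], and every word
     of the last shuffle ends in [xi1] *)
  apply spanned_eq with (T1 (S i) x ++
    T1 0 (scale (- (1)) (conc (mono [xi0]) (conc
      (linp (fun u => shuffle_word (repeat xi1 i) (u ++ [xi1])
                      ++ shuffle_word (repeat xi1 (S i)) u) q)
      (mono [xi1]))))).
  + intros f; rewrite lin_app, lin_T1_0, lin_scale, !lin_conc_l, !lin_T1, !hq.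
    rewrite lin_conc_r, lin_linp, !sh_nil_r.
    rewrite (lin_ext (fun u => sh f _ (xi0 :: u ++ [xi1]))
      (fun u => sh (fun u => f (xi1 :: u)) (repeat xi1 i) (xi0 :: u ++ [xi1]) +
        lin (fun u => f (xi0 :: u ++ [xi1]))
         (shuffle_word (repeat xi1 i) (u ++ [xi1]) ++ shuffle_word (repeat xi1 (S i)) u))).
    * rewrite lin_plus.
  cbn [repeat]; ring.
    * intros v; simpl repeat at 1; rewrite sh_cons, lin_app; f_equal.
      change (xi1 :: repeat xi1 i) with (repeat xi1 (S i)).
      pose proof (sh_snoc (fun u => f (xi0 :: u)) (repeat xi1 i) xi1 v xi1) as h.
      rewrite <- repeat_cons in h; exact h.
  + apply spanned_app; apply spanned_gen;
      [exact hS | apply in_S10_scale, in_S10_cons_snoc].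
Qed.

Lemma spanned_T10 w : spanned T10 in_S10 (mono w).
Proof.
destruct (spanned_T0 w) as [l [hl hp]].
apply spanned_eq with (flat_map (fun t => T0 (fst t) (snd t)) l); [now symmetry|].
apply spanned_flat_map; intros [j x] hx; cbn [fst snd].
rewrite Forall_forall in hl; specialize (hl _ hx); simpl in hl.
apply in_S0_lin in hl; destruct hl as [c [q hq]].
(* The constant part of [x] is treated apart, since [spanned_T1] concerns words ending in [xi1]. *)
apply spanned_eq with (scale c (T10 (0%nat, j) (mono [])) ++
  linp (fun u => T0 j (mono (u ++ [xi1]))) q).
{ intros f; rewrite lin_app, lin_scale, lin_T10, lin_T1, lin_mono, lin_T0, hq, lin_linp.
  simpl repeat; rewrite sh_nil_l; f_equal.
  apply lin_ext; intros u; now rewrite lin_T0, lin_mono. }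
apply spanned_app.
- apply spanned_scale; [exact in_S10_scale | exact T10_scale|].
  apply spanned_gen, in_S10_one.
- apply spanned_linp; [exact in_S10_scale | exact T10_scale|].
  intros u; destruct (spanned_T1 u) as [m [hm hu]].
  exists (map (fun t => ((fst t, j), snd t)) m); split; [now apply List.Forall_map|].
  intros f; rewrite lin_T0, hu; clear.
  induction m as [|t m IH]; simpl; [reflexivity|].
  now rewrite !lin_app, IH, lin_T10.
Qed.

Lemma Csum_head n (f : nat -> C) :
  (forall j, j <> 0%nat -> f j = 0) -> (n = 0%nat -> f 0%nat = 0) ->
  Csum n f = f 0%nat.
Proof.
intros h h0; destruct n as [|n]; [now rewrite h0|].
apply Csum_single; [lia | exact h].
Qed.

Definition collect {I} (eqd : forall a b : I, {a = b} + {a <> b}) (i : I)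
  (l : list (I * ncpoly)%type) : ncpoly :=
  flat_map (fun t => if eqd (fst t) i then snd t else []) l.

Lemma collect_closed {I} eqd (i : I) l (P : ncpoly -> Prop) :
  P [] -> (forall p q, P p -> P q -> P (p ++ q)) ->
  List.Forall (fun t => P (snd t)) l -> P (collect eqd i l).
Proof.
intros h0 h h1; induction h1 as [|t l ht hl IH]; [exact h0|].
apply h; [|exact IH]. lazymatch goal with |- context [eqd ?a ?b] => destruct (eqd a b) end; assumption.
Qed.

Lemma T0_nil f j : lin f (T0 j []) = 0.
Proof. now rewrite lin_T0. Qed.

Lemma T0_app f j p q : lin f (T0 j (p ++ q)) = lin f (T0 j p) + lin f (T0 j q).
Proof. now rewrite !lin_T0, lin_app. Qed.

Lemma T10_nil f t : lin f (T10 t []) = 0.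
Proof. now rewrite lin_T10, lin_T1. Qed.

Lemma T10_app f t p q : lin f (T10 t (p ++ q)) = lin f (T10 t p) + lin f (T10 t q).
Proof. now rewrite !lin_T10, !lin_T1, lin_app. Qed.

(** Entries of equal index are grouped, and [N] exceeds every index that occurs; positions without
    an entry get the zero component. *)
Lemma decomp0_exists w : exists ws, decomp0 (mono w) ws.
Proof.
destruct (spanned_T0 w) as [l [hl hp]].
set (N := S (list_max (map fst l))).
assert (hN : forall t, In t l -> (fst t < N)%nat).
{ intros t ht; pose proof (proj1 (list_max_le (map fst l) _) (le_n _)) as hm.
  rewrite List.Forall_forall in hm; specialize (hm (fst t) (in_map fst _ _ ht)).
  unfold N; lia. }
exists (map (fun j => collect Nat.eq_dec j l) (seq 0 N)); split.
- apply List.Forall_map, List.Forall_forall; intros j _.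
  apply collect_closed; [apply in_S10_S0, in_S10_nil | exact in_S0_app | exact hl].
- apply lin_nceq; intros f; rewrite hp, lin_ncsum, length_map, length_seq.
  transitivity (Csum N (fun j => lin f (T0 j (collect Nat.eq_dec j l)))).
  + clear hp hl; clearbody N; induction l as [|[i x] l IH]; cbn [flat_map].
    * rewrite (Csum_ext _ _ (fun _ => RtoC 0) (fun j _ => T0_nil f j)), Csum_0.
      reflexivity.
    * rewrite lin_app, IH by (intros; apply hN; now right).
      rewrite (Csum_ext _ (fun j => lin f (T0 j (collect Nat.eq_dec j ((i, x) :: l))))
        (fun j => lin f (T0 j (if Nat.eq_dec i j then x else [])) +
                  lin f (T0 j (collect Nat.eq_dec j l))))
        by (intros; apply T0_app).
      rewrite Csum_plus; f_equal; symmetry.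
      rewrite (Csum_single _ i).
      -- destruct (Nat.eq_dec i i) as [_|n]; [reflexivity | now destruct n].
      -- apply (hN (i, x)); now left.
      -- intros j hj; destruct (Nat.eq_dec i j); [congruence | apply T0_nil].
  + apply Csum_ext; intros j hj.
    rewrite (nth_indep _ _ (collect Nat.eq_dec 0%nat l)) by now rewrite length_map, length_seq.
    rewrite (map_nth (fun j => collect Nat.eq_dec j l)), seq_nth by exact hj.
    reflexivity.
Qed.

Definition pair_eq_dec : forall a b : nat * nat, {a = b} + {a <> b}.
Proof. decide equality; apply Nat.eq_dec. Defined.

Lemma decomp10_exists w : exists wss, decomp10 (mono w) wss.
Proof.
destruct (spanned_T10 w) as [l [hl hp]].
(* Bounding the sum of the two indices lets one [N] serve for rows and columns, so the table is
   square. *)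
set (N := S (list_max (map (fun t => (fst (fst t) + snd (fst t))%nat) l))).
assert (hN : forall t, In t l -> (fst (fst t) + snd (fst t) < N)%nat).
{ intros t ht.
  pose proof (proj1 (list_max_le (map (fun t => (fst (fst t) + snd (fst t))%nat) l) _)
                (le_n _)) as hm.
  rewrite List.Forall_forall in hm.
  specialize (hm _ (in_map (fun t => (fst (fst t) + snd (fst t))%nat) _ _ ht)).
  unfold N; cbv beta in hm; lia. }
set (row := fun i => map (fun j => collect pair_eq_dec (i, j) l) (seq 0 N)).
exists (map row (seq 0 N)); split.
- apply List.Forall_map, List.Forall_forall; intros i _.
  apply List.Forall_map, List.Forall_forall; intros j _.
  apply collect_closed; [apply in_S10_nil | exact in_S10_app | exact hl].
- apply lin_nceq; intros f; rewrite hp, lin_ncsum, length_map, length_seq.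
  transitivity (Csum N (fun i => Csum N (fun j =>
    lin f (T10 (i, j) (collect pair_eq_dec (i, j) l))))).
  + clear hp hl row; clearbody N; induction l as [|[[i k] x] l IH]; cbn [flat_map].
    * symmetry; transitivity (Csum N (fun _ => RtoC 0)); [|apply Csum_0].
      apply Csum_ext; intros i _; rewrite <- (Csum_0 N) at 1.
      apply Csum_ext; intros j _; apply T10_nil.
    * rewrite lin_app, IH by (intros; apply hN; now right).
      rewrite (Csum_ext _ (fun i0 => Csum N (fun j =>
          lin f (T10 (i0, j) (collect pair_eq_dec (i0, j) ((i, k, x) :: l)))))
        (fun i0 => Csum N (fun j =>
            lin f (T10 (i0, j) (if pair_eq_dec (i, k) (i0, j) then x else []))) +
          Csum N (fun j => lin f (T10 (i0, j) (collect pair_eq_dec (i0, j) l)))))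
        by (intros; rewrite <- Csum_plus; apply Csum_ext; intros; apply T10_app).
      specialize (hN ((i, k), x) (or_introl eq_refl)); simpl in hN.
      rewrite Csum_plus; f_equal; symmetry.
      rewrite (Csum_single _ i), (Csum_single _ k).
      -- destruct (pair_eq_dec (i, k) (i, k)) as [_|n]; [reflexivity | now destruct n].
      -- lia.
      -- intros j hj; destruct (pair_eq_dec (i, k) (i, j)); [congruence | apply T10_nil].
      -- lia.
      -- intros j hj; rewrite <- (Csum_0 N); apply Csum_ext.
         intros m _; destruct (pair_eq_dec (i, k) (j, m)); [congruence | apply T10_nil].
  + apply Csum_ext; intros i hi.
    assert (er : nth i (map row (seq 0 N)) [] = row i).
    { rewrite (nth_indep _ _ (row 0%nat)) by now rewrite length_map, length_seq.
      now rewrite (map_nth row), seq_nth by exact hi. }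
    rewrite lin_ncsum, er; unfold row at 1; rewrite length_map, length_seq.
    apply Csum_ext; intros j hj; unfold row.
    rewrite (nth_indep _ _ (collect pair_eq_dec (i, 0%nat) l))
      by now rewrite length_map, length_seq.
    rewrite (map_nth (fun j => collect pair_eq_dec (i, j) l)), seq_nth by exact hj.
    reflexivity.
Qed.

(** Needed for arguments of [zeta], which are polynomials and not single words; such an element is
    its own component of index 0. *)
Lemma decomp0_S0 p : in_S0 p -> exists ws, decomp0 p ws.
Proof.
intros h; exists [p]; split; [now repeat constructor|].
apply lin_nceq; intros f; rewrite lin_ncsum; unfold Csum.
cbn [length seq fold_right nth]; rewrite Cplus_0_r.
symmetry; exact (lin_T0_0 f p).
Qed.

(** * Characters evaluated through a chosen decomposition *)

Lemma nth_Forall {A} (P : A -> Prop) n l d : P d -> List.Forall P l -> P (nth n l d).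
Proof. intros hd h; revert n; induction h; intros [|n]; simpl; auto. Qed.

Lemma reg10_spec f w :
  sh_char f -> f [xi0] = 0 -> f [xi1] = 0 ->
  in_S10 (reg10 (mono w)) /\ f w = lin f (reg10 (mono w)).
Proof.
intros hf f0 f1; unfold reg10, components10.
pose proof (epsilon_spec (inhabits []) _ (decomp10_exists w)) as [hS hd].
set (wss := epsilon _ _) in *; clearbody wss; split.
- apply (nth_Forall in_S10); [apply in_S10_nil|].
  apply (nth_Forall (List.Forall in_S10)); [constructor | exact hS].
- rewrite <- (lin_mono f w), (nceq_lin _ _ hd), lin_ncsum.
  assert (e : forall i j x,
    lin f (shuffle (shuffle (letter_pow xi1 i) x) (letter_pow xi0 j)) =
    f (repeat xi1 i) * lin f x * f (repeat xi0 j)).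
  { intros i j x; rewrite !sh_char_lin by exact hf; unfold letter_pow.
    now rewrite !lin_mono. }
  rewrite Csum_head.
  + rewrite lin_ncsum, Csum_head.
    * rewrite e; simpl repeat; rewrite (proj1 hf); ring.
    * intros [|j] hj; [easy|].
      rewrite e, (sh_char_repeat_0 f xi0) by assumption; ring.
    (* An empty row contributes the empty sum, in agreement with its default component [[]], on
       which [lin f] is 0. *)
    * intros hl; apply length_zero_iff_nil in hl; rewrite hl, e; simpl; ring.
  + intros [|i] hi; [easy|]; rewrite lin_ncsum.
    set (m := length _); rewrite <- (Csum_0 m); apply Csum_ext.
    intros j _; rewrite e, (sh_char_repeat_0 f xi1) by assumption; ring.
  + intros hl; apply length_zero_iff_nil in hl; now rewrite hl.
Qed.

(** Reduces the definition of [Li] by choice to the construction of one character with prescribed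
    values on words ending in [xi1] and on [xi0]: it sends xi0^j to log^j z / j!. *)
Lemma Li_lin f p z :
  sh_char f -> (forall u, f (u ++ [xi1]) = Li_word (u ++ [xi1]) z) ->
  f [xi0] = Clog z -> (exists ws, decomp0 p ws) -> Li p z = lin f p.
Proof.
intros hf h1 h0 hex; unfold Li, components0.
pose proof (epsilon_spec (inhabits []) _ hex) as [hS hd].
set (ws := epsilon _ _) in *; clearbody ws.
rewrite (nceq_lin _ _ hd), lin_ncsum; apply Csum_ext; intros j hj.
rewrite sh_char_lin by exact hf; unfold letter_pow; rewrite lin_mono; f_equal.
- rewrite List.Forall_forall in hS; specialize (hS _ (nth_In _ [] hj)).
  apply in_S0_lin in hS; destruct hS as [c [q hq]].
  unfold Li0; rewrite !hq, (proj1 hf); f_equal; apply lin_ext; intros u; now rewrite h1.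
- pose proof (sh_char_repeat f xi0 j hf) as e; rewrite h0 in e.
  rewrite <- e; fold (natC (fact j)); field; apply natC_fact_neq_0.
Qed.

(** * Extended polylogarithms of words *)

(* [conv a b n] is the sum of [a i * b j] over [i + j = n]. *)
Fixpoint conv (a b : nat -> C) (n : nat) : C :=
  match n with
  | O => a O * b O
  | S n => a (S n) * b O + conv a (fun j => b (S j)) n
  end.

(** On generating series, [conv] is the product and [shift] is multiplication by the variable;
    [conv_shift] moves the variable from one factor to the other. *)
Definition shift (a : nat -> C) (n : nat) : C :=
  match n with O => 0 | S n => a n end.

Lemma conv_ext a a' b b' n :
  (forall m, a m = a' m) -> (forall m, b m = b' m) -> conv a b n = conv a' b' n.
Proof.
intros ha; revert b b'; induction n as [|n IH]; intros b b' hb; simpl;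
  rewrite ha, hb; [reflexivity|].
f_equal; apply IH; intros; apply hb.
Qed.

Lemma conv_plus_l a a' b n : conv (fun m => a m + a' m) b n = conv a b n + conv a' b n.
Proof. revert b; induction n as [|n IH]; intros b; simpl; [ring | rewrite IH; ring]. Qed.

Lemma conv_mul_l c a b n : conv (fun m => c * a m) b n = c * conv a b n.
Proof. revert b; induction n as [|n IH]; intros b; simpl; [ring | rewrite IH; ring]. Qed.

Lemma conv_mul_r c a b n : conv a (fun m => c * b m) n = c * conv a b n.
Proof.
revert b; induction n as [|n IH]; intros b; simpl; [ring|].
rewrite (IH (fun j => b (S j))); ring.
Qed.

Lemma conv_shift a b n : conv (shift a) b n = conv a (shift b) n.
Proof.
assert (h : forall n b, a n * b O + conv (shift a) (fun j => b (S j)) n = conv a b n).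
{ clear; intros n; induction n as [|n IH]; intros b; simpl; [ring|].
  now rewrite <- (IH (fun j => b (S j))). }
destruct n as [|n]; simpl; [ring|].
rewrite h; rewrite Cmult_0_r, Cplus_0_l; now apply conv_ext.
Qed.

Lemma conv_unit b n : conv (fun m => match m with O => 1 | S _ => 0 end) b n = b n.
Proof. revert b; induction n as [|n IH]; intros b; simpl; [ring | rewrite IH; ring]. Qed.

Lemma conv_cder (a b : nat -> C -> C) a' b' n z :
  (forall m, cder (a m) z (a' m)) -> (forall m, cder (b m) z (b' m)) ->
  cder (fun z => conv (fun m => a m z) (fun m => b m z) n) z
    (conv a' (fun m => b m z) n + conv (fun m => a m z) b' n).
Proof.
intros ha; revert b b'; induction n as [|n IH]; intros b b' hb; simpl.
- now apply cder_mult.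
- eapply cder_eq.
  + apply cder_plus; [apply cder_mult; [apply ha | apply hb]|].
    apply (IH (fun j => b (S j)) (fun j => b' (S j))); intros; apply hb.
  + cbv beta; ring.
Qed.

Lemma lin_cder (f : word -> C -> C) f' p z :
  (forall u, cder (f u) z (f' u)) ->
  cder (fun z => lin (fun u => f u z) p) z (lin f' p).
Proof.
intros h; induction p as [|[c u] p IH]; simpl; [apply cder_const|].
apply cder_plus; [apply cder_scal, h | exact IH].
Qed.

(** The polylogarithm of (v sh xi0^m) xi1: all its words end in [xi1], so the iterated integrals
    make sense. *)
Definition Li_sh (v : word) (m : nat) (z : C) : C :=
  sh (fun u => Li_word (u ++ [xi1]) z) v (repeat xi0 m).

Definition Li_sh_sgn (v : word) (m : nat) (z : C) : C := (- (1)) ^ m * Li_sh v m z.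

Definition log_pow (n : nat) (z : C) : C := Clog z ^ n / natC (fact n).

(* [Some v, n] stands for [v xi1 xi0^n] and [None, n] for [xi0^n]. *)
Fixpoint split_zeros (w : word) : option word * nat :=
  match w with
  | [] => (None, O)
  | a :: w =>
      match split_zeros w, a with
      | (Some v, n), _ => (Some (a :: v), n)
      | (None, n), xi0 => (None, S n)
      | (None, n), xi1 => (Some [], n)
      end
  end.

(* The extended polylogarithm on words, through
   [v xi1 xi0^n = sum_{i+j=n} (-1)^i ((v sh xi0^i) xi1) sh xi0^j]. *)
Definition Li_ext (w : word) (z : C) : C :=
  match split_zeros w with
  | (Some v, n) => conv (fun m => Li_sh_sgn v m z) (fun m => log_pow m z) n
  | (None, n) => log_pow n z
  end.

Lemma Li_word_cder_snoc a u z :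
  D0 z -> D1 z ->
  cder (Li_word (a :: u ++ [xi1])) z (form a z * Li_word (u ++ [xi1]) z).
Proof.
intros h0 h1; apply (Li_word_cder (a :: u)); [reflexivity | exact h0 | now apply D1_neq_0].
Qed.

(** The first letter, which differentiation removes, comes either from [a :: v] or from the power of
    [xi0]; the second source lowers [m] by one, hence the [shift]. *)
Lemma Li_sh_cder_cons a v m z :
  D0 z -> D1 z ->
  cder (Li_sh (a :: v) m) z
    (form a z * Li_sh v m z + form xi0 z * shift (fun m => Li_sh (a :: v) m z) m).
Proof.
intros h0 h1; unfold Li_sh; destruct m as [|m].
- apply cder_ext with (Li_word (a :: v ++ [xi1])).
  { exists 1%R; split; [lra|]; intros y _; simpl repeat; now rewrite sh_nil_r. }
  simpl repeat; rewrite sh_nil_r; eapply cder_eq; [now apply Li_word_cder_snoc|].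
  simpl shift; ring.
- apply cder_ext with (fun z =>
    sh (fun u => Li_word (a :: u ++ [xi1]) z) v (repeat xi0 (S m)) +
    sh (fun u => Li_word (xi0 :: u ++ [xi1]) z) (a :: v) (repeat xi0 m)).
  { exists 1%R; split; [lra|]; intros y _; simpl repeat; now rewrite sh_cons. }
  simpl shift; rewrite <- !sh_mul.
  apply cder_plus; (eapply lin_cder; intros u; now apply Li_word_cder_snoc).
Qed.

(** Now the word is xi0^m xi1, and [xi1] comes first only for m = 0. The resulting sequence 1, 0, 0,
    ... is the unit of [conv]. *)
Lemma Li_sh_cder_nil m z :
  D0 z -> D1 z ->
  cder (Li_sh [] m) z
    (form xi1 z * match m with O => 1 | S _ => 0 end +
     form xi0 z * shift (fun m => Li_sh [] m z) m).
Proof.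
intros h0 h1; unfold Li_sh.
apply cder_ext with (Li_word (repeat xi0 m ++ [xi1])).
{ exists 1%R; split; [lra|]; intros y _; now rewrite sh_nil_l. }
destruct m as [|m]; simpl shift.
- eapply cder_eq.
  + apply (Li_word_cder []); [reflexivity | exact h0 | now apply D1_neq_0].
  + simpl Li_word; ring.
- rewrite sh_nil_l; simpl repeat; eapply cder_eq; [now apply Li_word_cder_snoc|].
ring.
Qed.

(** Lowering [m] by one flips the sign (-1)^m, so the shifted term acquires the sign opposite to
    that in [log_pow_cder]. *)
Lemma sgn_cder f (a : nat -> C) g l m z :
  cder (f m) z (g * l + form xi0 z * shift a m) ->
  cder (fun z => (- (1)) ^ m * f m z) z
    (g * ((- (1)) ^ m * l) + - form xi0 z * shift (fun m => (- (1)) ^ m * a m) m).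
Proof.
intros h; eapply cder_eq; [apply cder_scal; exact h|].
destruct m as [|m]; simpl; ring.
Qed.

Lemma log_pow_cder m z :
  D1 z -> cder (log_pow m) z (form xi0 z * shift (fun m => log_pow m z) m).
Proof.
intros hz.
assert (hp : forall m, cder (fun z => Clog z ^ m) z
  (/ z * shift (fun m => natC (S m) * Clog z ^ m) m)).
{ clear m; intros m; induction m as [|m IH]; simpl.
  - eapply cder_eq; [apply cder_const | simpl; ring].
  - eapply cder_eq; [apply cder_mult; [now apply Clog_cder | exact IH]|].
    cbv beta; rewrite natC_S; destruct m as [|m]; simpl; [unfold natC; simpl; ring|].
    ring. }
unfold log_pow; eapply cder_ext; [|eapply cder_eq; [apply (cder_scal (/ natC (fact m))), hp|]].
- exists 1%R; split; [lra | intros y _; apply Cmult_comm].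
- destruct m as [|m]; simpl shift; [ring|]; unfold form.
  rewrite natC_fact_S, <- natC_S.
  pose proof (natC_fact_neq_0 m); pose proof (D1_neq_0 z hz).
  assert (natC (S m) <> 0).
  { intros e; apply RtoC_inj in e; pose proof (pos_INR m); rewrite S_INR in e; lra. }
  field; auto.
Qed.

Lemma Li_ext_cder a w z :
  D0 z -> D1 z -> cder (Li_ext (a :: w)) z (form a z * Li_ext w z).
Proof.
intros h0 h1; unfold Li_ext; simpl split_zeros.
(* Here [l m] is the part of the derivative without [shift]. The shifted part cancels against the
   derivative of the logarithms, by [conv_shift] and the alternating signs. *)
assert (hT : forall v f l, (forall m, cder (Li_sh v m) z
    (form f z * l m + form xi0 z * shift (fun m => Li_sh v m z) m)) ->
  forall n, cder (fun z => conv (fun m => Li_sh_sgn v m z) (fun m => log_pow m z) n) z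
    (form f z * conv (fun m => (- (1)) ^ m * l m) (fun m => log_pow m z) n)).
{ intros v f l h n; eapply cder_eq.
  - apply conv_cder; intros m; [|now apply log_pow_cder].
    apply (sgn_cder (Li_sh v) (fun m => Li_sh v m z)), h.
  - cbv beta; rewrite conv_plus_l, !conv_mul_l, conv_mul_r, conv_shift.
    unfold Li_sh_sgn; ring. }
destruct (split_zeros w) as [[v|] n].
- apply (hT (a :: v) a (fun m => Li_sh v m z)).
  intros m; now apply Li_sh_cder_cons.
(* In this case [w] is xi0^n. A prefixed [xi0] raises the power of the logarithm; a prefixed [xi1]
   leads to [v = []], where the convolution with its unit returns [log_pow n]. *)
- destruct a; [exact (log_pow_cder (S n) z h1)|].
  eapply cder_eq.
  + apply (hT [] xi1 (fun m => match m with O => 1 | S _ => 0 end)).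
    intros m; now apply Li_sh_cder_nil.
  + f_equal; rewrite <- (conv_unit (fun m => log_pow m z) n).
    apply conv_ext; [|reflexivity]; intros [|m]; simpl; ring.
Qed.

Lemma split_zeros_repeat n : split_zeros (repeat xi0 n) = (None, n).
Proof. induction n as [|n IH]; simpl; [reflexivity | now rewrite IH]. Qed.

Lemma split_zeros_In w : In xi1 w -> exists v, fst (split_zeros w) = Some v.
Proof.
induction w as [|a w IH]; simpl; [easy|].
intros h; destruct (split_zeros w) as [[v|] n]; simpl.
- now eexists.
- destruct h as [->|h]; [now eexists|]; destruct (IH h); discriminate.
Qed.

Lemma not_In_repeat w : ~ In xi1 w -> w = repeat xi0 (length w).
Proof.
induction w as [|[] w IH]; simpl; intros h; [reflexivity | | now destruct h; left].
f_equal; apply IH; auto.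
Qed.

Lemma split_zeros_snoc u : split_zeros (u ++ [xi1]) = (Some u, O).
Proof. induction u as [|a u IH]; simpl; [reflexivity | now rewrite IH]. Qed.

Lemma Li_ext_repeat n z : Li_ext (repeat xi0 n) z = log_pow n z.
Proof. unfold Li_ext; now rewrite split_zeros_repeat. Qed.

Lemma Li_ext_nil z : Li_ext [] z = 1.
Proof. unfold Li_ext, log_pow; simpl; unfold natC; simpl; field. Qed.

Lemma Li_ext_xi0 z : Li_ext [xi0] z = Clog z.
Proof. unfold Li_ext, log_pow; simpl; unfold natC; simpl; field. Qed.

Lemma Li_ext_snoc u z : Li_ext (u ++ [xi1]) z = Li_word (u ++ [xi1]) z.
Proof.
unfold Li_ext; rewrite split_zeros_snoc; simpl.
unfold Li_sh_sgn, Li_sh, log_pow; simpl; rewrite sh_nil_r; unfold natC; simpl; field.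
Qed.

(* [ord k f]: near [0], [f] is bounded by [|z|^k] up to powers of [log |z|]. *)
Definition log_size (z : C) : R := (4 + Rabs (ln (Cmod z)))%R.

Definition ord (k : nat) (f : C -> C) : Prop :=
  exists (K : R) (n : nat) (d : R), (0 <= K)%R /\ (0 < d)%R /\
    forall z, D0 z -> D1 z -> (Cmod z < d)%R ->
      (Cmod (f z) <= K * Cmod z ^ k * log_size z ^ n)%R.

Lemma log_size_ge_1 z : (1 <= log_size z)%R.
Proof. unfold log_size; pose proof (Rabs_pos (ln (Cmod z))); lra. Qed.

Lemma ord_ext k f g :
  (forall z, D0 z -> D1 z -> f z = g z) -> ord k f -> ord k g.
Proof.
intros h [K [n [d [hK [hd H]]]]]; exists K, n, d; repeat split; auto.
intros z h0 h1 hz; rewrite <- h by assumption; auto.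
Qed.

Lemma ord_plus k f g : ord k f -> ord k g -> ord k (fun z => f z + g z).
Proof.
intros [K [n [d [hK [hd H]]]]] [K' [n' [d' [hK' [hd' H']]]]].
exists (K + K')%R, (n + n')%nat, (Rmin d d').
split; [lra|]; split; [now apply Rmin_pos|].
intros z h0 h1 hz.
assert (hz1 : (Cmod z < d)%R) by (eapply Rlt_le_trans; [exact hz | apply Rmin_l]).
assert (hz2 : (Cmod z < d')%R) by (eapply Rlt_le_trans; [exact hz | apply Rmin_r]).
specialize (H z h0 h1 hz1); specialize (H' z h0 h1 hz2).
eapply Rle_trans; [apply Cmod_triangle|].
pose proof (log_size_ge_1 z) as hL; pose proof (Cmod_ge_0 z) as hm.
pose proof (pow_le _ k hm) as hk.
pose proof (pow_R1_Rle _ n hL) as p1; pose proof (pow_R1_Rle _ n' hL) as p2.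
rewrite pow_add.
assert (a1 : (K * Cmod z ^ k * log_size z ^ n <=
  K * Cmod z ^ k * (log_size z ^ n * log_size z ^ n'))%R).
{ apply Rmult_le_compat_l; [now apply Rmult_le_pos | nra]. }
assert (a2 : (K' * Cmod z ^ k * log_size z ^ n' <=
  K' * Cmod z ^ k * (log_size z ^ n * log_size z ^ n'))%R).
{ apply Rmult_le_compat_l; [now apply Rmult_le_pos | nra]. }
lra.
Qed.

Lemma ord_mult k l f g : ord k f -> ord l g -> ord (k + l) (fun z => f z * g z).
Proof.
intros [K [n [d [hK [hd H]]]]] [K' [n' [d' [hK' [hd' H']]]]].
exists (K * K')%R, (n + n')%nat, (Rmin d d').
split; [now apply Rmult_le_pos|]; split; [now apply Rmin_pos|].
intros z h0 h1 hz.
assert (hz1 : (Cmod z < d)%R) by (eapply Rlt_le_trans; [exact hz | apply Rmin_l]).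
assert (hz2 : (Cmod z < d')%R) by (eapply Rlt_le_trans; [exact hz | apply Rmin_r]).
rewrite Cmod_mult, !pow_add.
eapply Rle_trans;
  [apply Rmult_le_compat; [apply Cmod_ge_0 | apply Cmod_ge_0
                          | exact (H z h0 h1 hz1) | exact (H' z h0 h1 hz2)]|].
right; ring.
Qed.

Lemma ord_const c : ord 0 (fun _ => c).
Proof.
exists (Cmod c), 0%nat, 1%R; repeat split; [apply Cmod_ge_0 | lra|].
intros; simpl; lra.
Qed.

Lemma ord_0 k : ord k (fun _ => 0).
Proof.
exists 0%R, 0%nat, 1%R; repeat split; [lra | lra|].
intros; rewrite Cmod_0; lra.
Qed.

Lemma ord_scal k c f : ord k f -> ord k (fun z => c * f z).
Proof. exact (ord_mult 0 k (fun _ => c) f (ord_const c)). Qed.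

Lemma ord_weaken f : ord 1 f -> ord 0 f.
Proof.
intros [K [n [d [hK [hd H]]]]]; exists K, n, (Rmin d 1); split; [exact hK|].
split; [apply Rmin_pos; lra|]; intros z h0 h1 hz.
assert (hz1 : (Cmod z < d)%R) by (eapply Rlt_le_trans; [exact hz | apply Rmin_l]).
assert (hz2 : (Cmod z < 1)%R) by (eapply Rlt_le_trans; [exact hz | apply Rmin_r]).
eapply Rle_trans; [exact (H z h0 h1 hz1)|].
pose proof (log_size_ge_1 z) as hL; pose proof (Cmod_ge_0 z) as hm.
apply Rmult_le_compat_r; [apply pow_le; lra|]; simpl; nra.
Qed.

(** One term of the exponential series is at most the whole. *)
Lemma pow_le_exp x n : (0 <= x)%R -> (x ^ n <= INR (fact n) * exp x)%R.
Proof.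
intros hx; pose proof (exp_ge_taylor x n hx) as h.
pose proof (INR_fact_lt_0 n) as hf.
assert (hn : (x ^ n / INR (fact n) <= exp x)%R).
{ eapply Rle_trans; [|exact h].
  destruct n as [|n]; [simpl; lra|]; simpl sum_f_R0.
  assert (hp : (0 <= sum_f_R0 (fun k => x ^ k / INR (fact k)) n)%R).
  { apply cond_pos_sum; intros k; apply Rmult_le_pos; [now apply pow_le|].
    apply Rlt_le, Rinv_0_lt_compat, INR_fact_lt_0. }
  simpl in *; lra. }
apply (Rmult_le_compat_r (INR (fact n))) in hn; [|lra].
replace (x ^ n / INR (fact n) * INR (fact n))%R with (x ^ n)%R in hn by (field; lra).
lra.
Qed.

Lemma ord_lim f : ord 1 f ->
  forall eps, (0 < eps)%R -> exists d, (0 < d)%R /\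
    forall z, D0 z -> D1 z -> (Cmod z < d)%R -> (Cmod (f z) < eps)%R.
Proof.
intros [K [n [d [hK [hd H]]]]] e he.
(* With m = |z| and x = [log_size z] = 4 - ln m one has m exp x = exp 4, so x^(n+1) <= (n+1)! exp x
   yields K m x^n x < Q. Thus |f z| < Q / x, which is below the tolerance once x > Q / e. *)
set (Q := (K * (INR (fact (S n)) * exp 4) + 1)%R).
assert (hf : (0 < INR (fact (S n)))%R) by apply INR_fact_lt_0.
assert (hQ : (0 < Q)%R).
{ unfold Q; pose proof (exp_pos 4).
  assert (0 <= K * (INR (fact (S n)) * exp 4))%R
    by (apply Rmult_le_pos; [exact hK | apply Rmult_le_pos; lra]).
  lra. }
exists (Rmin d (exp (- (Q / e)))); split.
{ apply Rmin_pos; [exact hd | apply exp_pos]. }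
intros z h0 h1 hz.
assert (hz1 : (Cmod z < d)%R) by (eapply Rlt_le_trans; [exact hz | apply Rmin_l]).
assert (hz2 : (Cmod z < exp (- (Q / e)))%R) by (eapply Rlt_le_trans; [exact hz | apply Rmin_r]).
pose proof (proj1 (Cmod_gt_0 z) (D1_neq_0 z h1)) as hm.
specialize (H z h0 h1 hz1); rewrite pow_1 in H.
set (m := Cmod z) in *.
assert (hQe : (0 < Q / e)%R) by (apply Rdiv_lt_0_compat; lra).
assert (hln : (ln m < - (Q / e))%R) by (rewrite <- (ln_exp (- (Q / e))); now apply ln_increasing).
assert (hL : log_size z = (4 - ln m)%R) by (unfold log_size; fold m; rewrite Rabs_left; lra).
rewrite hL in H.
set (x := (4 - ln m)%R) in *.
assert (hx : (Q / e < x)%R) by (unfold x; lra).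
assert (hmx : (m * exp x = exp 4)%R).
{ unfold x; rewrite <- (exp_ln m) at 1 by exact hm; rewrite <- exp_plus; f_equal; ring. }
pose proof (pow_le_exp x (S n) ltac:(lra)) as hp; rewrite <- tech_pow_Rmult in hp.
assert (hb : (m * x ^ n * x <= INR (fact (S n)) * exp 4)%R).
{ rewrite <- hmx; apply (Rmult_le_compat_l m) in hp; lra. }
assert (hb2 : (K * m * x ^ n * x < Q)%R).
{ apply (Rmult_le_compat_l K) in hb; [unfold Q; lra | exact hK]. }
assert (hQx : (Q < e * x)%R).
{ apply (Rmult_lt_compat_l e) in hx; [|exact he].
  replace (e * (Q / e))%R with Q in hx by (field; lra); exact hx. }
eapply Rle_lt_trans; [exact H|].
apply Rmult_lt_reg_r with x; lra.
Qed.

Lemma ord_lin k (f : word -> C -> C) p :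
  (forall u, ord k (f u)) -> ord k (fun z => lin (fun u => f u z) p).
Proof.
intros h; induction p as [|[c u] p IH]; simpl; [apply ord_0|].
apply ord_plus; [apply ord_scal, h | exact IH].
Qed.

Lemma ord_conv k l (a b : nat -> C -> C) n :
  (forall m, ord k (a m)) -> (forall m, ord l (b m)) ->
  ord (k + l) (fun z => conv (fun m => a m z) (fun m => b m z) n).
Proof.
intros ha; revert b; induction n as [|n IH]; intros b hb; simpl.
- now apply ord_mult.
- apply ord_plus; [now apply ord_mult|].
  apply (IH (fun j => b (S j))); intros; apply hb.
Qed.

Lemma ord_Li_word u : ord 1 (Li_word (u ++ [xi1])).
Proof.
destruct (Li_word_factor u) as [g [hc hg]].
assert (h00 : D0 0) by (apply D0_iff; right; simpl; lra).
destruct (hc 0 h00 1%R ltac:(lra)) as [d [hd hn]].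
exists (Cmod (g 0) + 1)%R, 0%nat, d.
split; [pose proof (Cmod_ge_0 (g 0)); lra|]; split; [exact hd|].
intros z h0 _ hz; rewrite hg, Cmod_mult by exact h0.
specialize (hn z); replace (z - 0) with z in hn by ring; specialize (hn hz).
pose proof (Cmod_triangle_rev (g z) (g 0)); pose proof (Cmod_ge_0 z).
simpl; nra.
Qed.

Lemma ord_Clog : ord 0 Clog.
Proof.
exists 1%R, 1%nat, 1%R; split; [lra|]; split; [lra|].
intros z _ h1 _; simpl; rewrite !Rmult_1_r, Rmult_1_l.
replace (Clog z) with (RtoC (Re (Clog z)) + (0, Im (Clog z))%R)
  by (destruct (Clog z); unfold Cplus, RtoC; simpl; f_equal; ring).
eapply Rle_trans; [apply Cmod_triangle|]; rewrite Cmod_R.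
assert (e : Cmod (0, Im (Clog z))%R = Rabs (Im (Clog z))).
{ unfold Cmod; simpl.
  rewrite <- sqrt_Rsqr_abs; f_equal; unfold Rsqr; ring. }
rewrite e.
destruct (Clog_principal z h1) as [_ hi]; pose proof PI_4.
(* The constant 4 in [log_size] is there to dominate the argument. *)
assert (Rabs (Im (Clog z)) <= 4)%R by (apply Rabs_le; lra).
unfold log_size; change (Re (Clog z)) with (ln (Cmod z)); lra.
Qed.

Lemma ord_log_pow n : ord 0 (log_pow n).
Proof.
apply ord_ext with (fun z => / natC (fact n) * Clog z ^ n).
{ intros; unfold log_pow, Cdiv; ring. }
apply ord_scal; induction n as [|n IH]; simpl; [apply ord_const|].
exact (ord_mult 0 0 _ _ ord_Clog IH).
Qed.

Lemma ord_Li_ext_1 w : In xi1 w -> ord 1 (Li_ext w).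
Proof.
intros h; destruct (split_zeros_In w h) as [v hv]; unfold Li_ext.
destruct (split_zeros w) as [o n]; simpl in hv; subst o.
apply (ord_conv 1 0 (fun m => Li_sh_sgn v m) log_pow); [|exact ord_log_pow].
intros m; unfold Li_sh_sgn; apply ord_scal; unfold Li_sh, sh.
apply ord_lin; exact ord_Li_word.
Qed.

Lemma ord_Li_ext w : ord 0 (Li_ext w).
Proof.
destruct (in_dec letter_eq_dec xi1 w) as [h|h]; [now apply ord_weaken, ord_Li_ext_1|].
rewrite (not_In_repeat w h).
eapply ord_ext; [|exact (ord_log_pow (length w))].
intros; now rewrite Li_ext_repeat.
Qed.

(** The prefix [p] collects the letters already removed by the shuffle recursion, since the required
    [xi1] may be among them. *)
Lemma ord_sh_Li_ext p u v :
  In xi1 (p ++ u ++ v) -> ord 1 (fun z => sh (fun w => Li_ext (p ++ w) z) u v).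
Proof.
revert p v; induction u as [|a u IHu]; intros p v h.
{ eapply ord_ext; [|exact (ord_Li_ext_1 (p ++ v) h)]; intros; now rewrite sh_nil_l. }
revert p h; induction v as [|b v IHv]; intros p h.
{ eapply ord_ext; [|apply (ord_Li_ext_1 (p ++ a :: u))].
  - intros; now rewrite sh_nil_r.
  - now rewrite app_nil_r in h. }
apply ord_ext with (fun z => sh (fun w => Li_ext ((p ++ [a]) ++ w) z) u (b :: v) +
                             sh (fun w => Li_ext ((p ++ [b]) ++ w) z) (a :: u) v).
{ intros z _ _; rewrite sh_cons; f_equal; apply sh_ext; intros w;
    now rewrite <- app_assoc. }
apply ord_plus; [apply IHu | apply IHv].
- now rewrite <- app_assoc.
- rewrite !in_app_iff in h |- *; simpl in h |- *; rewrite in_app_iff; tauto.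
Qed.

(** * Multiplicativity of the extended polylogarithms *)

Lemma small_point d : (0 < d)%R -> exists z, D0 z /\ D1 z /\ (Cmod z < d)%R.
Proof.
intros hd; set (r := Rmin (d / 2) (1 / 2)).
assert (hr : (0 < r)%R) by (apply Rmin_pos; lra).
assert (r <= d / 2)%R by apply Rmin_l.
assert (r <= 1 / 2)%R by apply Rmin_r.
exists (RtoC r); repeat split.
- intros [_ h]; simpl in h; lra.
- intros [_ h]; simpl in h; lra.
- rewrite Cmod_R, Rabs_pos_eq; lra.
Qed.

Lemma ord_const_0 F :
  (forall z, D0 z -> D1 z -> cder F z 0) -> ord 1 F ->
  forall z, D0 z -> D1 z -> F z = 0.
Proof.
intros hF h z h0 h1; apply Cmod_eq_0.
destruct (Req_dec (Cmod (F z)) 0) as [e|n]; [exact e|].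
pose proof (Cmod_ge_0 (F z)).
destruct (ord_lim F h (Cmod (F z)) ltac:(lra)) as [d [hd H']].
destruct (small_point d hd) as [y [y0 [y1 hy]]].
specialize (H' y y0 y1 hy).
rewrite (cder_0_const F hF y z y0 y1 h0 h1) in H'; lra.
Qed.

(** Double induction: differentiation removes a first letter on both sides, so the derivative of the
    defect [F] vanishes by the induction hypotheses. If [xi1] occurs, [F] has order 1 at 0 and is
    therefore 0; otherwise both words are powers of [xi0] and the claim is the rule for log^m times
    log^n. *)
Lemma Li_ext_char z : D0 z -> D1 z -> sh_char (fun w => Li_ext w z).
Proof.
intros h0 h1; split; [apply Li_ext_nil|]; intros u v; revert z h0 h1.
revert v; induction u as [|a u IHu]; intros v z h0 h1.
{ now rewrite sh_nil_l, Li_ext_nil, Cmult_1_l. }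
revert z h0 h1; induction v as [|b v IHv]; intros z h0 h1.
{ now rewrite sh_nil_r, Li_ext_nil, Cmult_1_r. }
destruct (in_dec letter_eq_dec xi1 ((a :: u) ++ (b :: v))) as [h|h].
- set (F := fun z => sh (fun w => Li_ext w z) (a :: u) (b :: v) +
               - (1) * (Li_ext (a :: u) z * Li_ext (b :: v) z)).
  assert (hF : F z = 0).
  { apply ord_const_0; [| | exact h0 | exact h1]; unfold F.
    - clear z h0 h1; intros z h0 h1.
      apply cder_ext with (fun z =>
        (sh (fun w => Li_ext (a :: w) z) u (b :: v) +
         sh (fun w => Li_ext (b :: w) z) (a :: u) v) +
        - (1) * (Li_ext (a :: u) z * Li_ext (b :: v) z)).
      { exists 1%R; split; [lra|]; intros y _; now rewrite sh_cons. }
      eapply cder_eq.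
      + apply cder_plus; [apply cder_plus |].
        * apply lin_cder; intros w; now apply Li_ext_cder.
        * apply lin_cder; intros w; now apply Li_ext_cder.
        * apply cder_scal, cder_mult; now apply Li_ext_cder.
      + rewrite !lin_mul.
        change (form a z * sh (fun w => Li_ext w z) u (b :: v) +
          form b z * sh (fun w => Li_ext w z) (a :: u) v +
          - (1) * (form a z * Li_ext u z * Li_ext (b :: v) z +
             Li_ext (a :: u) z * (form b z * Li_ext v z)) = 0).
        rewrite IHu, IHv by assumption; ring.
    - apply ord_plus; [now apply (ord_sh_Li_ext [])|].
      apply ord_scal; apply in_app_iff in h; destruct h as [h|h].
      + exact (ord_mult 1 0 _ _ (ord_Li_ext_1 _ h) (ord_Li_ext _)).
      + exact (ord_mult 0 1 _ _ (ord_Li_ext _) (ord_Li_ext_1 _ h)). }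
  unfold F in hF.
  match goal with |- ?x = ?y => replace x with (x + - (1) * y + y) by ring end.
  rewrite hF; ring.
- rewrite in_app_iff in h.
  pose proof (not_In_repeat (a :: u) ltac:(tauto)) as eu.
  pose proof (not_In_repeat (b :: v) ltac:(tauto)) as ev.
  revert eu ev; generalize (length (a :: u)) (length (b :: v)); intros m n -> ->.
  pose proof (sh_repeat (fun w => Li_ext w z) xi0 m n) as e.
  rewrite !Li_ext_repeat in *; unfold log_pow in *.
  pose proof (natC_fact_neq_0 m); pose proof (natC_fact_neq_0 n).
  pose proof (natC_fact_neq_0 (m + n)).
  match goal with |- ?x = _ =>
    replace x with (/ (natC (fact m) * natC (fact n)) *
                    (natC (fact m) * natC (fact n) * x)) by (field; auto) end.
  rewrite e, Li_ext_repeat; unfold log_pow; rewrite Cpow_add_r; field; auto.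
Qed.

(** * The inversion formula *)

Lemma dsum_cder (F : word -> word -> C -> C) F' w z :
  (forall u v, cder (F u v) z (F' u v)) ->
  cder (fun z => dsum (fun u v => F u v z) w) z (dsum F' w).
Proof.
revert F F'; induction w as [|a w IH]; intros F F' h; simpl; apply cder_plus;
  [apply h | apply cder_const | apply h | apply IH; intros; apply h].
Qed.

(* The sum telescopes: moving the first letter of [v] to the end of [u]
   exchanges the two kinds of terms. *)
Lemma dsum_telescope (f f' g g' : word -> C) (phi : letter -> C) w :
  (forall u a, f' (u ++ [a]) = - phi a * f u) ->
  g' [] = 0 -> (forall a v, g' (a :: v) = phi a * g v) ->
  dsum (fun u v => f' u * g v + f u * g' v) w = f' [] * g w.
Proof.
intros hf hg0 hg; revert f f' hf; induction w as [|a w IH]; intros f f' hf; simpl.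
- rewrite hg0; ring.
- rewrite (IH (fun u => f (a :: u)) (fun u => f' (a :: u))).
  + rewrite hg; pose proof (hf [] a) as h; simpl in h; rewrite h; ring.
  + intros u b; exact (hf (a :: u) b).
Qed.

Lemma D01_1_minus z : D0 z -> D1 z -> D0 (1 - z) /\ D1 (1 - z).
Proof. intros h0 h1; split; [now apply D1_1_minus | now apply D0_1_minus]. Qed.

Definition inversion_sum (w : word) (z : C) : C :=
  dsum (fun u v => Li_ext (tau_word u) (1 - z) * Li_ext v z) w.

(** The reason for exchanging letters in [tau]: z -> 1 - z exchanges the two forms up to the sign of
    dz, and that sign makes the derivative telescope. *)
Lemma form_swap a z : form (swap a) (1 - z) = form a z.
Proof. destruct a; simpl; [f_equal; ring | reflexivity]. Qed.

Lemma tau_word_snoc u a : tau_word (u ++ [a]) = swap a :: tau_word u.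
Proof. unfold tau_word; now rewrite map_app, rev_app_distr. Qed.

Lemma tau_word_cons u a : tau_word (a :: u) = tau_word u ++ [swap a].
Proof. reflexivity. Qed.

Lemma Li_ext_cder_ex w z :
  D0 z -> D1 z -> cder (Li_ext w) z
    match w with [] => 0 | a :: v => form a z * Li_ext v z end.
Proof.
intros h0 h1; destruct w as [|a v]; [|now apply Li_ext_cder].
apply cder_ext with (fun _ => RtoC 1); [|apply cder_const].
exists 1%R; split; [lra|]; intros y _; now rewrite Li_ext_nil.
Qed.

Lemma inversion_sum_cder w z : D0 z -> D1 z -> cder (inversion_sum w) z 0.
Proof.
intros h0 h1; destruct (D01_1_minus z h0 h1) as [k0 k1].
set (g' := fun v => match v with [] => RtoC 0 | a :: v => form a z * Li_ext v z end).
set (f' := fun u => - (1) * match tau_word u with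
   | [] => RtoC 0 | a :: v => form a (1 - z) * Li_ext v (1 - z) end).
eapply cder_eq.
- apply (dsum_cder (fun u v z => Li_ext (tau_word u) (1 - z) * Li_ext v z)
    (fun u v => f' u * Li_ext v z + Li_ext (tau_word u) (1 - z) * g' v)).
  intros u v; apply (cder_mult (fun z => Li_ext (tau_word u) (1 - z)) (Li_ext v)); [|now apply Li_ext_cder_ex].
  eapply cder_eq; [apply (cder_comp (Li_ext (tau_word u)) (fun z => 1 - z));
    [apply cder_1_minus | now apply Li_ext_cder_ex]|].
  unfold f'; ring.
(* Reversal in [tau] puts the last letter of [u] first, so differentiating the left factor removes
   exactly the letter adjacent to [v]. The boundary term left over is the derivative of the constant
   Li(1; 1 - z). *)
- rewrite (dsum_telescope _ _ _ _ (fun a => form a z)).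
  + unfold f'; simpl; ring.
  + intros u a; unfold f'; rewrite tau_word_snoc, form_swap; ring.
  + reflexivity.
  + reflexivity.
Qed.

Lemma D01_half : D0 (RtoC (1 / 2)) /\ D1 (RtoC (1 / 2)).
Proof. split; intros [_ h]; simpl in h; lra. Qed.

(** The common value of the sum on the whole domain, by [inversion_sum_const]; 1/2 is just one
    convenient point of it. *)
Definition inversion_const (w : word) : C := inversion_sum w (RtoC (1 / 2)).

Lemma inversion_sum_const w z :
  D0 z -> D1 z -> inversion_sum w z = inversion_const w.
Proof.
intros h0 h1; apply cder_0_const; try apply D01_half; try assumption.
intros y; apply inversion_sum_cder.
Qed.

Lemma inversion_const_char : sh_char inversion_const.
Proof.
destruct D01_half as [h0 h1], (D01_1_minus _ h0 h1) as [k0 k1].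
apply (dsum_char (fun u => Li_ext (tau_word u) (1 - RtoC (1 / 2)))
                 (fun v => Li_ext v (RtoC (1 / 2)))).
- exact (sh_char_tau (fun u => Li_ext u _) (Li_ext_char _ k0 k1)).
- exact (Li_ext_char _ h0 h1).
Qed.

Lemma inversion_const_letter a : inversion_const [a] = 0.
Proof.
destruct D01_half as [h0 h1], (D01_1_minus _ h0 h1) as [k0 k1].
unfold inversion_const, inversion_sum; set (z := RtoC (1 / 2)) in *.
destruct a; simpl; rewrite !Li_ext_nil, !Li_ext_xi0, (Li_ext_snoc []).
- rewrite (Clog_Li z h1); simpl app; ring.
- rewrite (Clog_Li (1 - z) k1); simpl app.
  replace (1 - (1 - z)) with z by ring; ring.
Qed.

(** * Behaviour at 1 and identification with zeta *)

Lemma ord_dsum k (F : word -> word -> C -> C) w :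
  (forall u v, u ++ v = w -> ord k (F u v)) ->
  ord k (fun s => dsum (fun u v => F u v s) w).
Proof.
revert F; induction w as [|a w IH]; intros F h; simpl; apply ord_plus.
- now apply h.
- apply ord_0.
- now apply h.
- apply (IH (fun u v => F (a :: u) v)); intros u v <-; now apply h.
Qed.

(** Constancy at the point 1 - s, solved for the term with empty left factor: the other terms
    involve only polylogarithms at [s] and, at 1 - s, those of proper suffixes. *)
Lemma inversion_sum_cons a w s :
  D0 s -> D1 s ->
  inversion_const (a :: w) + - (1) *
    dsum (fun u v => Li_ext (tau_word (a :: u)) s * Li_ext v (1 - s)) w =
  Li_ext (a :: w) (1 - s).
Proof.
intros h0 h1; destruct (D01_1_minus s h0 h1) as [k0 k1].
rewrite <- (inversion_sum_const _ (1 - s) k0 k1); unfold inversion_sum; simpl dsum.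
replace (1 - (1 - s)) with s by ring.
change (tau_word []) with (@nil letter); rewrite Li_ext_nil; ring.
Qed.

Lemma ord_Li_ext_at_1 w : ord 0 (fun s => Li_ext w (1 - s)).
Proof.
remember (length w) as n eqn:e; revert w e.
induction n as [n IH] using (well_founded_induction Wf_nat.lt_wf); intros w e.
destruct w as [|a w].
{ eapply ord_ext; [|exact (ord_const 1)]; intros; now rewrite Li_ext_nil. }
eapply ord_ext; [intros s; apply inversion_sum_cons|].
apply ord_plus; [apply ord_const|]; apply ord_scal.
apply (ord_dsum 0 (fun u v s => Li_ext (tau_word (a :: u)) s * Li_ext v (1 - s))).
intros u v <-; apply (ord_mult 0 0); [apply ord_Li_ext|].
apply (IH (length v)); [|reflexivity].
subst n; simpl; rewrite length_app; lia.
Qed.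

(** A leading [xi0] makes each [tau_word (xi0 :: u)] end in [xi1], so every remaining term has a
    factor vanishing at s = 0. This is where convergence of the zeta values enters. *)
Lemma ord_Li_ext_xi0_at_1 w :
  ord 1 (fun s => Li_ext (xi0 :: w) (1 - s) + - (1) * inversion_const (xi0 :: w)).
Proof.
apply ord_ext with (fun s => - (1) *
    dsum (fun u v => Li_ext (tau_word (xi0 :: u)) s * Li_ext v (1 - s)) w).
{ intros s h0 h1; rewrite <- inversion_sum_cons by assumption; ring. }
apply ord_scal.
apply (ord_dsum 1 (fun u v s => Li_ext (tau_word (xi0 :: u)) s * Li_ext v (1 - s))).
intros u v _; apply (ord_mult 1 0); [|apply ord_Li_ext_at_1].
apply ord_Li_ext_1; rewrite tau_word_cons; apply in_app_iff; right; now left.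
Qed.

Lemma Li_eq_ext p z :
  D0 z -> D1 z -> (exists ws, decomp0 p ws) -> Li p z = lin (fun w => Li_ext w z) p.
Proof.
intros h0 h1 hex; apply Li_lin; [now apply Li_ext_char | | apply Li_ext_xi0 | exact hex].
intros u; apply Li_ext_snoc.
Qed.

Lemma Li_mono u z : D0 z -> D1 z -> Li (mono u) z = Li_ext u z.
Proof.
intros h0 h1; rewrite Li_eq_ext by auto using decomp0_exists.
exact (lin_mono (fun w => Li_ext w z) u).
Qed.

Lemma Li_tau_mono u z : D0 z -> D1 z -> Li (tau (mono u)) z = Li_ext (tau_word u) z.
Proof.
intros h0 h1; rewrite Li_eq_ext; try assumption.
- rewrite lin_tau; exact (lin_mono (fun u => Li_ext (tau_word u) z) u).
- destruct (decomp0_exists (tau_word u)) as [ws [hS hd]].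
  exists ws; split; [exact hS|]; intros w; rewrite <- hd; unfold coeff.
  now rewrite lin_tau, !lin_mono.
Qed.

Lemma Csum_splits F w :
  Csum (S (length w)) (fun k => F (firstn k w) (skipn k w)) = dsum F w.
Proof.
revert F; induction w as [|a w IH]; intros F; rewrite Csum_shift; simpl; [reflexivity|].
f_equal; apply (IH (fun u v => F (a :: u) v)).
Qed.

Lemma ord_Li_S10 p : in_S10 p ->
  ord 1 (fun s => lin (fun w => Li_ext w (1 - s)) p + - (1) * lin inversion_const p).
Proof.
intros h; apply in_S10_lin in h; destruct h as [c [q hq]].
apply ord_ext with (fun s => lin (fun u =>
  Li_ext (xi0 :: u ++ [xi1]) (1 - s) + - (1) * inversion_const (xi0 :: u ++ [xi1])) q).
{ intros s _ _; rewrite !hq, lin_plus, lin_mul, Li_ext_nil.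
  rewrite (proj1 inversion_const_char); ring. }
apply (ord_lin 1 (fun u s => Li_ext (xi0 :: u ++ [xi1]) (1 - s) +
  - (1) * inversion_const (xi0 :: u ++ [xi1]))).
intros u; apply ord_Li_ext_xi0_at_1.
Qed.

Lemma zeta_S10 p : in_S10 p -> zeta p = lin inversion_const p.
Proof.
intros hp; unfold zeta.
(* [zeta] is defined by [iota], so the limit has to be unique; this holds because 1 is adherent to
   the domain. *)
assert (hF : ProperFilter' (within (fun z : C => D0 z /\ D1 z) (locally (RtoC 1)))).
{ constructor; [|apply within_filter, locally_filter].
  intros [d hd].
  destruct (small_point d (cond_pos d)) as [s [h0 [h1 hs]]].
  destruct (D01_1_minus s h0 h1) as [k0 k1].
  apply (hd (1 - s)); [|now split].
  apply C_NormedModule_mixin_compat1; change (Cmod (1 - s - 1) < d)%R.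
  replace (1 - s - 1) with (- s) by ring; now rewrite Cmod_opp. }
apply (iota_filterlim_locally (V := C_R_CompleteNormedModule)).
assert (e1 : forall y : C, 1 - (1 - y) = y) by (intros; ring).
assert (e2 : forall a b : C, a - b = a + - (1) * b) by (intros; ring).
intros P [e he]; pose proof (cond_pos e) as hpos.
destruct (ord_lim _ (ord_Li_S10 p hp) e hpos) as [d [hd H]].
(* Balls of C are products of intervals: radius d/2 bounds the modulus by sqrt 2 * (d/2) <= d. *)
assert (hd2 : (0 < d / 2)%R) by lra.
exists (mkposreal _ hd2); intros y hy [y0 y1].
apply he, C_NormedModule_mixin_compat1.
destruct (D01_1_minus y y0 y1) as [k0 k1].
assert (hyd : (Cmod (1 - y) < d)%R).
{ rewrite Cmod_minus_sym.
  pose proof (C_NormedModule_mixin_compat2 (RtoC 1) y (mkposreal _ hd2) hy) as h.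
  change (Cmod (y - 1) < sqrt 2 * (d / 2))%R in h.
  eapply Rlt_le_trans; [exact h|].
  assert (sqrt 2 <= 2)%R by (rewrite <- (sqrt_square 2) at 2 by lra; apply sqrt_le_1; lra).
  nra. }
specialize (H (1 - y) k0 k1 hyd).
rewrite (e1 y) in H.
change (Cmod (Li p y - lin inversion_const p) < e)%R.
rewrite Li_eq_ext by (auto using decomp0_S0, in_S10_S0).
rewrite e2; exact H.
Qed.

Theorem proposition8 (w : word) (z : C) (hz0 : D0 z) (hz1 : D1 z) :
  Csum (S (length w)) (fun k =>
    Li (tau (mono (firstn k w))) (1 - z) * Li (mono (skipn k w)) z)
  = zeta (reg10 (mono w)).
Proof.
destruct (D01_1_minus z hz0 hz1) as [k0 k1].
destruct (reg10_spec inversion_const w inversion_const_char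
  (inversion_const_letter xi0) (inversion_const_letter xi1)) as [hS e].
rewrite (zeta_S10 _ hS), <- e, <- (inversion_sum_const w z hz0 hz1).
unfold inversion_sum; rewrite <- Csum_splits.
apply Csum_ext; intros k _; now rewrite Li_tau_mono, Li_mono.
Qed.
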